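(* Let $n\ge 3$ be odd and let $A\in M_n(\mathbb C)$ be a 2-periodic reciprocal matrix with $A_1\neq A_2$. If $n\equiv 1 \pmod 4$, then none of the rank-$k$ numerical ranges $\Lambda_k(A)$ has an elliptical shape. Otherwise (that is, if $n\equiv 3\pmod 4$), exactly one of the rank-$k$ numerical ranges of $A$, namely $\Lambda_{(n+1)/4}(A)$, is an elliptical disk.
   Context: $M_n(\mathbb C)$ is the algebra of $n\times n$ complex matrices. For $A\in M_n(\mathbb C)$ the rank-$k$ numerical range ($k=1,\dots,n$) is $\Lambda_k(A)=\{\lambda\in\mathbb C\colon PAP=\lambda P\text{ for some rank-}k\text{ orthogonal projection }P\}$. A matrix $A=(a_{ij})\in M_n(\mathbb C)$ is tridiagonal if $a_{ij}=0$ whenever $|i-j|>1$. A tridiagonal matrix is 2-periodic if the sequence of its diagonal entries is 2-periodic ($a_{i+2,i+2}=a_{ii}$) and the sequence of its unordered off-diagonal pairs is 2-periodic ($\{a_{i+2,i+3},a_{i+3,i+2}\}=\{a_{i,i+1},a_{i+1,i}\}$ as unordered pairs), for all indices for which this makes sense. A reciprocal matrix is a tridiagonal matrix with constant main diagonal and with $a_{i,i+1}a_{i+1,i}=1$ for $i=1,\ldots,n-1$. For a reciprocal matrix, $A_j=\frac12\left(|a_{j+1,j}|^2+|a_{j,j+1}|^2\right)$, $j=1,\ldots,n-1$. ''Elliptical disk'' / ''elliptical shape'' means the closed region bounded by a non-degenerate ellipse (circles allowed); in particular, the empty set, single points and line segments are not elliptical disks. *)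

(* Defs.v *)
From mathcomp Require Import all_boot all_order all_algebra.
From mathcomp Require Import classical_sets reals complex.

Set Implicit Arguments.
Unset Strict Implicit.
Unset Printing Implicit Defensive.

Import Order.TTheory GRing.Theory Num.Theory.

Local Open Scope ring_scope.
Local Open Scope classical_set_scope.
Local Open Scope complex_scope.
Local Open Scope sesquilinear_scope.

(* Ordinals index rows and columns from 0, so that A i j, with i j : 'I_n,    *)
(* is the entry usually written a_{i+1,j+1}.                                  *)

Definition orth_proj (R : realType) (n : nat) (P : 'M[R[i]]_n) : Prop :=
  P *m P = P /\ P ^t* = P.

Definition rank_num_range (R : realType) (n k : nat) (A : 'M[R[i]]_n) :
  set R[i] :=
  [set z | exists P : 'M[R[i]]_n,
    [/\ orth_proj P, \rank P = k & P *m A *m P = z *: P]].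

Definition tridiagonal (R : realType) (n : nat) (A : 'M[R[i]]_n) : Prop :=
  forall i j : 'I_n, (i.+1 < j)%N || (j.+1 < i)%N -> A i j = 0.

(* Unordered pairs are compared as two-element sequences up to permutation.   *)
Definition two_periodic (R : realType) (n : nat) (A : 'M[R[i]]_n) : Prop :=
  [/\ tridiagonal A,
      forall i j : 'I_n, j = i.+2 :> nat -> A j j = A i i
    & forall i i' j j' : 'I_n,
        i' = i.+1 :> nat -> j = i.+2 :> nat -> j' = i.+3 :> nat ->
        perm_eq [:: A j j'; A j' j] [:: A i' i; A i i']].

Definition reciprocal (R : realType) (n : nat) (A : 'M[R[i]]_n) : Prop :=
  [/\ tridiagonal A,
      forall i j : 'I_n, A i i = A j j
    & forall i j : 'I_n, j = i.+1 :> nat -> A i j * A j i = 1].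

(* The entry a_{p,q}, for p and q counted from 0; it is 0 outside the matrix. *)
Definition entry (R : realType) (n : nat) (A : 'M[R[i]]_n) (p q : nat) : R[i] :=
  if (insub p, insub q) is (Some i, Some j) then A i j else 0.

(* The mean A_j, for j counted from 1 (hence the shift); it is meaningful for *)
(* 1 <= j <= n - 1.                                                           *)
Definition offdiag_mean (R : realType) (n : nat) (A : 'M[R[i]]_n) (j : nat) :
  R[i] :=
  (`|entry A j j.-1| ^+ 2 + `|entry A j.-1 j| ^+ 2) / 2.

(* The focal description of an ellipse with foci f1 and f2 and major axis of  *)
(* length d. The strict inequality excludes segments, points and the empty    *)
(* set; f1 = f2 gives the circular disks.                                     *)
Definition elliptical_disk (R : realType) (E : set R[i]) : Prop :=
  exists (f1 f2 : R[i]) (d : R),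
    `|f1 - f2| < d%:C /\ E = [set z | `|z - f1| + `|z - f2| <= d%:C].

(* Main.v *)
(* Write m = (n - 1) / 2 and                                                  *)
(*   F_j(c) = (A_1 + A_2) / 2 + c + kappa_j * sqrt ((A_1 + c) (A_2 + c))      *)
(* with kappa_j = cos (j pi / (m + 1)). For A centered at 0, the eigenvalues  *)
(* of Re (e^(i theta) A) are 0 and +- sqrt (F_j (cos 2 theta)), so that for   *)
(* k <= m every point z of Lambda_k(A) satisfies                              *)
(*   (Re (e^(i theta) z))^2 <= F_k (cos 2 theta).                             *)
(* When 2 k = m + 1 we have kappa_k = 0 and this bound describes an ellipse,  *)
(* which is reached because deleting every fourth row and column of A leaves  *)
(* k decoupled 3 x 3 blocks whose numerical range is that ellipse.            *)
(*   Otherwise sqrt ((A_1 + c) (A_2 + c)), strictly concave in c, has a       *)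
(* nonzero coefficient. An elliptical Lambda_k(A) has a squared support       *)
(* function affine in (cos, sin) (2 theta), and this is contradicted by       *)
(* points close to the vertex of the bounding region on the real axis. Such a *)
(* point z, with the strict bound, belongs to Lambda_k(A): T = - B^* B^-1,    *)
(* with B = A - z, preserves the form B, hence the space spanned by its       *)
(* eigenvectors for eigenvalues in the open unit disk is isotropic for B.     *)
(* These eigenvalues are roots of det (t B + B^* ), which splits into         *)
(* self-inversive quartics, and at least k of them are in the disk since the  *)
(* bound keeps the quartics from having too many unimodular roots.            *)

(* The outline above is carried by the following facts. Opposite off-diagonal entries of a pencil in
   [centered A a] and its adjoint have products that alternate between two values depending only on
   [A1] and [A2], so every such determinant is a Chebyshev continuant ([det_pencil]). With
   interlacing ([hermitian_compression_le]) this gives the outer bound [rank_num_range_le]; with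
   root counting for self-inversive quartics and an isotropy argument it gives the partial converse
   [rank_num_range_below], which [rank_num_range_near] turns into an exact description of the range
   near the real vertex.

   For the contradiction, put c = cos (2 theta). The squared support function of an ellipse,
   averaged over theta and - theta, is affine in c and at most F_k. But F_k is strictly convex when
   kappa_k < 0 and strictly concave when kappa_k > 0. Auxiliary ellipses with contact points near
   the vertex then force the affine function to be too large: on tangent lines of F_k in the convex
   case ([kappa_neg_impossible]), on a secant line in the concave case ([kappa_pos_impossible]).

   Ranks k > m leave at most the point a ([large_rank_not_elliptical]), and 2 k = m + 1 is the
   elliptical case ([half_rank_elliptical]). Such a k exists exactly when m is odd. *)
Require Import Defs.
From mathcomp Require Import all_boot all_order all_algebra.
From mathcomp Require Import classical_sets reals complex.
From mathcomp Require Import boolp topology normedtype trigo realfun.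
From mathcomp Require Import ring lra zify.

Set Implicit Arguments.
Unset Strict Implicit.
Unset Printing Implicit Defensive.

Import Order.TTheory GRing.Theory Num.Theory.

Local Open Scope ring_scope.
Local Open Scope sesquilinear_scope.

(** * Determinants of periodic tridiagonal matrices *)

Section Continuant.
Variable T : comNzRingType.

(** Determinant of the tridiagonal matrix of size [i] with constant diagonal [L] and constant
    products [P] of opposite entries; for [P = 1] it is the Chebyshev polynomial of the second kind
    at L / 2. *)
Fixpoint continuant (L P : T) (i : nat) : T :=
  if i is j.+1 then
    if j is k.+1 then L * continuant L P j - P * continuant L P k else L
  else 1.

Lemma continuantSS L P i :
  continuant L P i.+2 = L * continuant L P i.+1 - P * continuant L P i.
Proof. by []. Qed.

Variable f : nat -> nat -> T.
Hypothesis f_tridiag : forall i j, (i.+1 < j)%N || (j.+1 < i)%N -> f i j = 0.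

Let D n := \det (\matrix_(i < n, j < n) f i j).

Lemma det_tridiag_rec n :
  D n.+2 = f n.+1 n.+1 * D n.+1 - f n n.+1 * f n.+1 n * D n.
Proof.
have lift_max k (i : 'I_k) : lift ord_max i = i :> nat.
  by rewrite /= /bump leqNgt ltn_ord.
rewrite {1}/D (expand_det_row _ ord_max) !big_ord_recr /=.
rewrite big1 ?add0r; last first.
  by move=> j _; rewrite mxE f_tridiag ?mul0r //= ltnS ltn_ord orbT.
rewrite !mxE /= addrC; congr (_ + _).
  rewrite /cofactor /= -signr_odd addnn odd_double expr0 mul1r.
  congr (_ * \det _); apply/matrixP=> i j; rewrite !mxE.
  by congr f; rewrite -[RHS]lift_max /=.
rewrite [f n n.+1 * _]mulrC -mulrA -mulrN; congr (_ * _).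
rewrite /cofactor /= addSn addnn -signr_odd /= odd_double expr1 mulN1r; congr (- _).
set N := row' _ _.
rewrite (expand_det_col N ord_max) big_ord_recr /= big1 ?add0r; last first.
  move=> i _; rewrite !mxE f_tridiag ?mul0r //.
  rewrite /= /bump; case: i => i /= ii. clear - ii; lia.
have -> : N ord_max ord_max = f n n.+1.
  by rewrite !mxE; congr f; rewrite /= /bump; lia.
have -> : cofactor N ord_max ord_max = D n => [|//].
rewrite /cofactor /= -signr_odd addnn odd_double expr0 mul1r.
rewrite /D; congr (\det _); apply/matrixP=> i j; rewrite !mxE.
by case: i j => [i Hi] [j Hj]; congr f; rewrite /= /bump; lia.
Qed.

(** Eliminating the determinants of even size from three consecutive steps of [det_tridiag_rec]
    leaves a recursion between odd sizes whose coefficients no longer alternate. *)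
Lemma det_tridiag_periodic (d X Y : T) m :
    (forall i, (i <= m.*2)%N -> f i i = d) ->
    (forall i, (i < m.*2)%N -> f i i.+1 * f i.+1 i = if odd i then Y else X) ->
  D m.*2.+1 = d * continuant (d ^+ 2 - X - Y) (X * Y) m.
Proof.
have D0 : D 0 = 1 by rewrite /D det_mx00.
have D1 : D 1 = f 0 0 by rewrite /D det_mx11 mxE.
elim/ltn_ind: m => -[|[|m]] IH fd fXY.
- by rewrite D1 fd //= mulr1.
- rewrite det_tridiag_rec (det_tridiag_rec 0) D0 D1 !fd // !fXY //=; ring.
rewrite continuantSS.
have H1 : D m.*2.+3 = d * continuant (d ^+ 2 - X - Y) (X * Y) m.+1.
  by rewrite -(IH m.+1) // => i Hi; [apply: fd | apply: fXY]; lia.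
have H0 : D m.*2.+1 = d * continuant (d ^+ 2 - X - Y) (X * Y) m.
  by rewrite -(IH m) // => i Hi; [apply: fd | apply: fXY]; lia.
have E5 : D m.*2.+1.+4 = d * D m.*2.+4 - Y * D m.*2.+3.
  rewrite det_tridiag_rec fd ?fXY; try lia.
  by rewrite /= odd_double.
have E4 : D m.*2.+4 = d * D m.*2.+3 - X * D m.*2.+2.
  rewrite det_tridiag_rec fd ?fXY; try lia.
  by rewrite /= odd_double.
have E3 : D m.*2.+3 = d * D m.*2.+2 - Y * D m.*2.+1.
  rewrite det_tridiag_rec fd ?fXY; try lia.
  by rewrite /= odd_double.
rewrite !doubleS E5 E4.
have -> : d * (d * D m.*2.+3 - X * D m.*2.+2) - Y * D m.*2.+3 =
  (d ^+ 2 - X - Y) * D m.*2.+3 - X * Y * D m.*2.+1.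
  rewrite E3.
  ring.
by rewrite H1 H0; ring.
Qed.

End Continuant.

(** * Roots of the Chebyshev polynomials of the second kind *)

Section Chebyshev.
Variable R : realType.

Definition kappa (m j : nat) : R := cos (j%:R * pi / m.+1%:R).

Lemma kappa_arg_itv m j : (j <= m.+1)%N ->
  j%:R * pi / m.+1%:R \in `[0 : R, pi].
Proof.
move=> jm; rewrite in_itv /= divr_ge0 ?mulr_ge0 ?pi_ge0 //=.
by rewrite ler_pdivrMr // mulrC ler_wpM2l ?pi_ge0 // ler_nat.
Qed.

Lemma kappa_lt m i j : (j <= m.+1)%N -> (i < j)%N -> kappa m j < kappa m i.
Proof.
move=> jm ij; rewrite /kappa ltr_cos ?kappa_arg_itv //; last by lia.
by rewrite ltr_pM2r ?invr_gt0 ?ltr0n // ltr_pM2r ?pi_gt0 // ltr_nat.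
Qed.

Lemma kappa_le m i j : (j <= m.+1)%N -> (i <= j)%N -> kappa m j <= kappa m i.
Proof.
move=> jm; rewrite leq_eqVlt => /orP[/eqP->//|ij].
by rewrite ltW ?kappa_lt.
Qed.

Lemma kappa_rev m j : (j <= m.+1)%N -> kappa m (m.+1 - j) = - kappa m j.
Proof.
move=> jm; rewrite /kappa natrB //.
have -> : (m.+1%:R - j%:R) * pi / m.+1%:R = - (j%:R * pi / m.+1%:R) + pi :> R.
  by field; rewrite nat1r pnatr_eq0.
by rewrite cosDpi cosN.
Qed.

Lemma kappa_bounds m j : (0 < j <= m)%N -> -1 < kappa m j < 1.
Proof.
move=> /andP[j0 jm].
have -> : 1 = kappa m 0 :> R by rewrite /kappa !mul0r cos0.
have -> : - kappa m 0 = kappa m m.+1 by rewrite -kappa_rev.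
by rewrite !kappa_lt //; lia.
Qed.

Lemma kappa_gt0 m j : (j.*2 < m.+1)%N -> 0 < kappa m j.
Proof.
move=> jm; have := @kappa_lt m j (m.+1 - j).
rewrite kappa_rev; last by lia.
by move=> /(_ ltac:(lia) ltac:(lia)); lra.
Qed.

Lemma kappa_eq0 m j : j.*2 = m.+1 -> kappa m j = 0.
Proof.
move=> jm; have := @kappa_rev m j; rewrite (_ : (_ - _)%N = j); last by lia.
by move=> /(_ ltac:(lia)); lra.
Qed.

Lemma kappa_lt0 m j : (j <= m.+1)%N -> (m.+1 < j.*2)%N -> kappa m j < 0.
Proof.
move=> jm jm2; have := @kappa_gt0 m (m.+1 - j).
by rewrite kappa_rev // => /(_ ltac:(lia)); lra.
Qed.

Lemma sin_continuant (x : R) i :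
  sin x * continuant (2 * cos x) 1 i = sin (i.+1%:R * x).
Proof.
elim/ltn_ind: i => -[|[|i]] IH; first by rewrite /= mulr1 mul1r.
  by rewrite (mulr_natl x 2) sin_mulr2n /=; ring.
rewrite continuantSS mul1r mulrBr mulrCA IH // IH //.
have -> : i.+3%:R * x = i.+2%:R * x + x by rewrite -[in LHS]natr1; ring.
have -> : i.+1%:R * x = i.+2%:R * x - x by rewrite -[in RHS]natr1; ring.
by rewrite sinB sinD; ring.
Qed.

Lemma horner_continuant (x : R) i :
  (continuant 'X 1 i : {poly R}).[x] = continuant x 1 i.
Proof.
elim/ltn_ind: i => -[|[|i]] IH; first by rewrite /= hornerC.
  by rewrite /= hornerX.
by rewrite !continuantSS !mul1r hornerD hornerN hornerM hornerX !IH.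
Qed.

Lemma size_continuantX i :
  (size (continuant 'X 1 i : {poly R}) = i.+1) /\
  (continuant 'X 1 i : {poly R}) \is monic.
Proof.
elim/ltn_ind: i => -[|[|i]] IH; rewrite ?size_poly1 ?monic1 ?size_polyX ?monicX //.
rewrite continuantSS mul1r.
have [s1 m1] := IH i.+1 ltac:(lia); have [s0 m0] := IH i ltac:(lia).
have sX : size ('X * continuant 'X 1 i.+1 : {poly R}) = i.+3.
  by rewrite size_monicM ?monicX -?size_poly_eq0 ?s1 // size_polyX.
split; first by rewrite size_polyDl // sX size_polyN s0.
by rewrite monicE lead_coefDl ?sX ?size_polyN ?s0 // -monicE monicMl ?monicX.
Qed.

(** By [sin_continuant] the numbers 2 kappa_j are roots, as sin ((m + 1) x) vanishes at x = j pi /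
    (m + 1) and sin x does not; they are distinct, and a monic polynomial of degree [m] has no
    others. *)
Lemma continuant_poly m :
  continuant 'X 1 m = \prod_(j < m) ('X - (2 * kappa m j.+1)%:P) :> {poly R}.
Proof.
have [sm mm] := size_continuantX m.
rewrite [LHS](@all_roots_prod_XsubC _ _ [seq 2 * kappa m j.+1 | j : 'I_m]).
- by rewrite (monicP mm) scale1r big_image.
- by rewrite sm size_image card_ord.
- apply/allP=> _ /mapP[j _ ->]; rewrite /root horner_continuant.
  have jm : (j.+1 <= m)%N by [].
  have := sin_continuant (j.+1%:R * pi / m.+1%:R) m.
  have -> : m.+1%:R * (j.+1%:R * pi / m.+1%:R) = pi *+ j.+1 :> R.
    by rewrite -mulr_natl; field; rewrite nat1r pnatr_eq0.
  have -> : sin (pi *+ j.+1) = 0 :> R.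
    elim: (j.+1) => [|i IH]; first by rewrite mulr0n sin0.
    by rewrite mulrSr sinDpi IH oppr0.
  move=> /eqP; rewrite mulf_eq0 => /orP[/eqP s0|//].
  have := @sin_gt0_pi R (j.+1%:R * pi / m.+1%:R); rewrite s0 ltxx => H.
  suff: false by []; apply: H.
  rewrite divr_gt0 ?mulr_gt0 ?pi_gt0 ?ltr0n //=.
  by rewrite ltr_pdivrMr // mulrC ltr_pM2l ?pi_gt0 // ltr_nat.
- rewrite uniq_rootsE map_inj_uniq ?enum_uniq //.
  move=> i j /mulfI-/(_ ltac:(by rewrite pnatr_eq0)) E.
  apply/val_inj => /=; have := ltn_ord i; have := ltn_ord j.
  have [ij|ij|//] := ltngtP i j => jm im.
  + by have := @kappa_lt m i.+1 j.+1; rewrite E ltxx => /(_ ltac:(lia) ltac:(lia)).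
  + by have := @kappa_lt m j.+1 i.+1; rewrite E ltxx => /(_ ltac:(lia) ltac:(lia)).
Qed.

End Chebyshev.

Section ContinuantFactor.
Variables (R : realType) (F : fieldType) (iota : {rmorphism R -> F}).

Lemma continuant_scale (L s : F) i :
  continuant (s * L) (s ^+ 2) i = s ^+ i * continuant L 1 i.
Proof.
elim/ltn_ind: i => -[|[|i]] IH; rewrite ?mulr1 ?expr1 //.
by rewrite !continuantSS !IH // !exprS; ring.
Qed.

Lemma continuant_sqr_factor (L s : F) m :
  continuant L (s ^+ 2) m =
  \prod_(j < m) (L - iota (2 * kappa R m j.+1) * s).
Proof.
(* The rescaling used for the main case divides by [s]. *)
have [->|s0] := eqVneq s 0.
  under eq_bigr do rewrite mulr0 subr0.
  rewrite big_const_ord iter_mulr_1 expr0n /=.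
  elim/ltn_ind: m => -[|[|i]] IH //.
  by rewrite continuantSS mul0r subr0 IH // exprS.
have -> : L = s * (L / s) by rewrite mulrC divfK.
rewrite continuant_scale.
have -> : continuant (L / s) 1 m = (map_poly iota (continuant 'X 1 m)).[L / s].
  elim/ltn_ind: m => -[|[|i]] IH; first by rewrite /= rmorph1 hornerC.
    by rewrite /= map_polyX hornerX.
  rewrite !continuantSS !mul1r rmorphB rmorphM hornerD hornerN hornerM [X in X.[_] * _]map_polyX hornerX.
  by rewrite (IH i.+1) // (IH i).
rewrite continuant_poly rmorph_prod horner_prod.
rewrite -[s in s ^+ m]mulr1 -{1}[m]card_ord -prodr_const mulr1 -big_split /=.
apply: eq_bigr => j _.
by rewrite rmorphB /= map_polyX map_polyC !hornerE /=; ring.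
Qed.

(** Multiplying the factorization by itself in reverse order pairs the opposite values kappa_j and
    kappa_(m+1-j), so only [s ^+ 2] remains. This keeps the factors polynomial even when the product
    [P] has no polynomial square root. *)
Lemma continuant_sqr (L s : F) m :
  continuant L (s ^+ 2) m ^+ 2 =
  \prod_(j < m) (L ^+ 2 - iota (4 * kappa R m j.+1 ^+ 2) * s ^+ 2).
Proof.
rewrite expr2 {1}(continuant_sqr_factor L s) (continuant_sqr_factor L s).
rewrite {1}(reindex_inj rev_ord_inj) -big_split /=; apply: eq_bigr => j _.
have -> : (m - j.+1).+1 = (m.+1 - j.+1)%N by have := ltn_ord j; lia.
rewrite kappa_rev; last by rewrite ltnS ltnW.
rewrite expr2 !rmorphM rmorphN !rmorph_nat /=; ring.
Qed.

End ContinuantFactor.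

(** * Invariant and isotropic subspaces *)

Section InvariantSubspace.
Variable F : fieldType.

Lemma horner_char_poly n (A : 'M[F]_n) x : (char_poly A).[x] = \det (x%:M - A).
Proof.
rewrite horner_sum; apply: eq_bigr => s _.
rewrite hornerM horner_exp !hornerE; congr (_ * _).
rewrite (big_morph _ (fun p q => hornerM p q x) (hornerC 1 x)).
by apply: eq_bigr => i _; rewrite !mxE !(hornerE, hornerMn).
Qed.

Lemma char_poly_conj n (P T : 'M[F]_n) : P \in unitmx ->
  char_poly (P *m T *m invmx P) = char_poly T.
Proof.
move=> Pu; pose lift := map_mx (@polyC F) : 'M_n -> 'M_n.
have PPV : lift P *m lift (invmx P) = 1%:M.
  by rewrite /lift -map_mxM mulmxV // map_mx1.
have -> : char_poly (P *m T *m invmx P) =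
    \det (lift P *m char_poly_mx T *m lift (invmx P)).
  congr (\det _); rewrite /char_poly_mx mulmxBr mulmxBl; congr (_ - _).
    by rewrite scalar_mxC -mulmxA PPV mulmx1.
  by rewrite !map_mxM.
rewrite !det_mulmx mulrAC -[\det _ * \det _]det_mulmx PPV det1 mul1r //.
Qed.

(** Schur triangularization when the characteristic polynomial splits: split off a left eigenvector
    and recurse on the quotient. The order of [rs] is free, so any chosen eigenvalues can be put
    first. *)
Lemma invariant_flag n (T : 'M[F]_n) (rs : seq F) k :
    char_poly T = \prod_(r <- rs) ('X - r%:P) -> (k <= n)%N ->
  exists (V : 'M[F]_(k, n)) (U : 'M[F]_k),
    [/\ row_free V, V *m T = U *m V, is_trig_mx U &
        forall i : 'I_k, U i i = rs`_i].
Proof.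
elim: k n T rs => [|k IH] n T rs cT kn.
  exists 0, 0; split; last by case.
  - by rewrite /row_free mxrank0.
  - by rewrite !mul0mx.
  - by apply/is_trig_mxP=> -[].
case: n T cT kn => // n T cT kn.
case: rs cT => [|r rs] cT.
  have := size_char_poly T; rewrite cT big_nil size_poly1; lia.
have /eigenvalueP[v vT v0] : eigenvalue T r.
  by rewrite eigenvalue_root_char cT root_prod_XsubC mem_head.
(* [P] completes [v], up to a scalar, to a basis: its first row is proportional to [v]. *)
pose P : 'M_(1 + n) := row_ebase v.
have Pu : P \in unitmx by exact: row_ebase_unit.
have rkv : \rank v = 1%N by rewrite rank_rV v0.
have vP : v = (col_ebase v) 0 0 *: usubmx P.
  rewrite -{1}(mulmx_ebase v) rkv -mulmxA.
  have -> (Q : 'M[F]_(1 + n)) : (pid_mx 1 : 'M_(1, 1 + n)) *m Q = usubmx Q.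
    by rewrite pid_mx_row -{1}[Q]vsubmxK mul_row_col mul1mx mul0mx addr0.
  by rewrite {1}[col_ebase v]mx11_scalar mul_scalar_mx.
have c0 : col_ebase v 0 0 != 0.
  by apply: contraNneq v0 => c0; rewrite vP c0 scale0r.
have uP : usubmx P *m T = r *: usubmx P.
  apply: (scalerI c0).
  by rewrite scalemxAl -vP vT scalerA mulrC -scalerA -vP.
pose T' : 'M_(1 + n) := P *m T *m invmx P.
have uT : usubmx T' = row_mx r%:M 0.
  rewrite /T' -[P in P *m T]vsubmxK !mul_col_mx col_mxKu uP -scalemxAl.
  have -> : usubmx P *m invmx P = row_mx 1%:M 0.
    have := mulmxV Pu; rewrite -{1}[P]vsubmxK mul_col_mx => /(congr1 usubmx).
    by rewrite col_mxKu scalar_mx_block /block_mx col_mxKu.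
  by rewrite scale_row_mx scaler0 scalemx1.
have T'E : T' = block_mx r%:M 0 (dlsubmx T') (drsubmx T').
  rewrite -[LHS]submxK; congr block_mx.
    by rewrite /ulsubmx uT row_mxKl.
  by rewrite /ursubmx uT row_mxKr.
set c := dlsubmx T' in T'E; set S := drsubmx T' in T'E.
have cS : char_poly S = \prod_(s <- rs) ('X - s%:P).
  have : char_poly T' = ('X - r%:P) * char_poly S.
    rewrite T'E /char_poly /char_poly_mx map_block_mx map_mx0.
    rewrite scalar_mx_block opp_block_mx add_block_mx oppr0 addr0 det_lblock.
    by rewrite det_mx11 !mxE eqxx !mulr1n.
  rewrite char_poly_conj // cT big_cons => /mulfI-> //.
  by rewrite polyXsubC_eq0.
have [V [U [Vf VS Ut Ud]]] := IH n S rs cS kn.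
exists (block_mx 1%:M 0 0 V *m P : 'M_(1 + k, n.+1)).
exists (block_mx r%:M 0 (V *m c) U : 'M_(1 + k)); split.
- rewrite /row_free mxrankMfree ?row_free_unit //.
  by rewrite (@rank_diag_block_mx _ 1 1 k n) mxrank1 (eqP Vf).
- have E : block_mx 1%:M 0 0 V *m T' = block_mx r%:M 0 (V *m c) U *m block_mx 1%:M 0 0 V.
    rewrite [in LHS]T'E !mulmx_block.
    by rewrite !(mul1mx, mulmx1, mul0mx, mulmx0, addr0, add0r) VS.
  by rewrite mulmxA -E -!mulmxA (mulVmx Pu) mulmx1.
- by rewrite (@is_trig_block_mx _ 1 k 1 k) // eqxx Ut mx11_is_trig.
- move=> i; rewrite -(@splitK 1 k i); case: (@split 1 k i) => j /=.
    by rewrite (@block_mxEul _ 1 k 1 k) mxE eqxx !ord1.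
  by rewrite (@block_mxEdr _ 1 k 1 k) Ud.
Qed.

End InvariantSubspace.

Section Isotropic.
Variable C : numClosedFieldType.

(** The Gram matrix satisfies G = U G U^*. By induction on i + j, triangularity reduces this to G_ij
    = U_ii conj(U_jj) G_ij, where the factor has modulus less than 1. *)
Lemma isotropic_contraction n k (B T : 'M[C]_n) (V : 'M[C]_(k, n)) (U : 'M[C]_k) :
    T *m B *m T^t* = B -> V *m T = U *m V -> is_trig_mx U ->
    (forall i, `|U i i| < 1) ->
  V *m B *m V^t* = 0.
Proof.
move=> TB VT /is_trig_mxP Ut U1; set G := V *m B *m V^t*.
have GE : G = U *m G *m U^t*.
  rewrite /G -{1}TB !mulmxA VT -!mulmxA.
  by rewrite -map_mxM -trmx_mul VT trmx_mul map_mxM !mulmxA.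
suff H s : forall i j : 'I_k, (i + j < s)%N -> G i j = 0.
  by apply/matrixP=> i j; rewrite (H (i + j).+1) // mxE.
elim: s => // s IH i j ijs.
have Gij : G i j = U i i * (U j j)^* * G i j.
  rewrite {1}GE mxE (bigD1 j) //= big1 ?addr0 => [|b bj].
    rewrite mxE (bigD1 i) //= big1 ?addr0 => [|a ai].
      by rewrite !mxE mulrAC.
    have [ia|ia] := ltnP i a; first by rewrite Ut ?mul0r.
    rewrite IH ?mulr0 //; have : (a < i)%N by rewrite ltn_neqAle ai ia.
    by clear -ijs; lia.
  rewrite !mxE; have [jb|jb] := ltnP j b; first by rewrite Ut // conjC0 mulr0.
  rewrite big1 ?mul0r // => a _.
  have [ia|ia] := ltnP i a; first by rewrite Ut ?mul0r.
  rewrite IH ?mulr0 //; have : (b < j)%N by rewrite ltn_neqAle bj jb.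
  by clear -ijs ia; lia.
apply/eqP; apply: contraTT (lexx (`|U i i| * `|U j j|)) => G0.
have E : U i i * (U j j)^* = 1 by apply: (mulIf G0); rewrite mul1r -Gij.
have : `|U i i| * `|U j j| = 1 by rewrite -[`|U j j|]norm_conjC -normrM E normr1.
move=> E1; have : `|U i i| * `|U j j| < 1 by apply: mulr_ilt1.
by rewrite E1 ltxx.
Qed.

Lemma unitary_isotropic n k (B : 'M[C]_n) (V : 'M[C]_(k, n)) :
    row_free V -> V *m B *m V^t* = 0 ->
  exists2 U : 'M[C]_(k, n), U \is unitarymx & U *m B *m U^t* = 0.
Proof.
move=> Vf VB.
have kn : (k <= n)%N by rewrite -(eqP Vf) rank_leq_col.
exists (schmidt V); first exact: schmidt_unitarymx.
have /submxP[M ->] : (schmidt V <= V)%MS.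
  by rewrite (eqmx_schmidt_free Vf).
rewrite trmx_mul map_mxM !mulmxA -(mulmxA M V) -(mulmxA M) .
by rewrite VB mulmx0 mul0mx.
Qed.

(** One half of the Courant-Fischer principle: fewer than [k] eigenvectors are excluded, so the row
    space of [U] contains a nonzero vector in the span of the others, where the form is at most [l]
    times the squared norm. *)
Lemma hermitian_compression_le n k (H : 'M[C]_n) (rs : seq C) (U : 'M[C]_(k, n)) t l :
    H^t* = H -> char_poly H = \prod_(r <- rs) ('X - r%:P) ->
    (count (fun r => ~~ (r <= l)%R) rs < k)%N ->
    U \is unitarymx -> U *m H *m U^t* = t%:M ->
  t <= l.
Proof.
move=> Hh cH cnt Uu UHU.
have : H \is normalmx by apply/normalmxP; rewrite Hh.
move=> /orthomx_spectralP; set Q := spectralmx H; set d := spectral_diag H => HE.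
have Qu : Q \is unitarymx by exact: spectral_unitarymx.
have Qi : Q \in unitmx by exact: unitarymx_unit.
have rsd : perm_eq rs [seq d 0 i | i : 'I_n].
  apply: prod_XsubC_eq; rewrite -cH HE -{2}[Q]invmxK char_poly_conj ?unitmx_inv //.
  rewrite char_poly_trig ?diag_mx_is_trig // big_image.
  by apply: eq_bigr => i _; rewrite mxE eqxx.
pose big := [set i | ~~ (d 0 i <= l)].
have cbig : (#|big| < k)%N.
  rewrite (permP rsd) in cnt; apply: leq_ltn_trans cnt.
  rewrite -sum1_card -sum1_count big_image_cond /=.
  by under eq_bigl do rewrite inE.
pose W := U *m Q^t*.
(* [N] has fewer columns than rows; a nonzero row vector in its kernel combines the rows of [U] into
   a vector without component along the excluded eigenvectors. *)
pose N := colsub (fun i : 'I_#|big| => enum_val i) W.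
have : kermx N != 0.
  rewrite kermx_eq0 /row_free; apply: contraTneq cbig => <-.
  by rewrite -leqNgt rank_leq_col.
move=> /rowV0Pn[a /sub_kermxP aN a0].
pose w := a *m W.
have wb i : ~~ (d 0 i <= l) -> w 0 i = 0.
  move=> ib; have ib' : i \in big by rewrite inE.
  have E : (a *m N) 0 (enum_rank_in ib' i) = 0 by rewrite aN mxE.
  rewrite mxE in E; rewrite /w mxE -[RHS]E.
  by apply: eq_bigr => j _; rewrite [N _ _]mxE enum_rankK_in.
have norm_row m (x : 'rV[C]_m) : (x *m x^t*) 0 0 = \sum_i `|x 0 i| ^+ 2.
  by rewrite mxE; apply: eq_bigr => i _; rewrite !mxE normCK.
have ww : w *m w^t* = a *m a^t*.
  rewrite /w /W !trmx_mul !map_mxM trmxCK !mulmxA mulmxKtV //.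
  by rewrite mulmxtVK.
have wdw : w *m diag_mx d *m w^t* = t%:M *m (a *m a^t*).
  rewrite /w /W !trmx_mul !map_mxM trmxCK.
  have -> : t%:M *m (a *m a^t*) = a *m t%:M *m a^t* by rewrite mulmxA scalar_mxC.
  by rewrite -UHU HE invmx_unitary // !mulmxA.
have aa0 : 0 < (a *m a^t*) 0 0.
  rewrite norm_row lt_neqAle sumr_ge0 ?andbT => [|i _]; last by rewrite exprn_ge0.
  rewrite eq_sym psumr_neq0 => [|i _]; last by rewrite exprn_ge0.
  have /rV0Pn[i ai] := a0.
  by apply/hasP; exists i; rewrite ?mem_index_enum //= exprn_gt0 ?normr_gt0.
rewrite -(ler_pM2r aa0) -ww.
have -> : t * (w *m w^t*) 0 0 = \sum_i d 0 i * `|w 0 i| ^+ 2.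
  rewrite ww; have /matrixP/(_ 0 0) := wdw; rewrite mul_scalar_mx [in RHS]mxE => <-.
  rewrite mxE; apply: eq_bigr => i _.
  by rewrite mul_mx_diag !mxE normCK; ring.
rewrite norm_row mulr_sumr; apply: ler_sum => i _.
have [dl|/wb->] := boolP (d 0 i <= l); last by rewrite normr0 expr0n !mulr0.
by rewrite ler_wpM2r ?exprn_ge0.
Qed.

End Isotropic.

(** * Compressions of a reciprocal matrix *)

Section RankRange.
Variable R : realType.
Local Notation C := R[i].

(** An orthogonal projection of rank [k] is [U^t* *m U] for the rows of [U] an orthonormal basis of
    its range, so the range can be studied through compressions to [k] dimensions. *)
Lemma rank_num_rangeP n k (A : 'M[C]_n) z :
  rank_num_range k A z <->
  exists2 U : 'M[C]_(k, n), U \is unitarymx & U *m A *m U^t* = z%:M.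
Proof.
split=> [[P [[PP Ph] rP PAP]]|[U Uu UAU]].
  subst k; have kn : (\rank P <= n)%N by rewrite rank_leq_row.
  pose U := schmidt (row_base P).
  have Uu : U \is unitarymx by exact: schmidt_unitarymx.
  exists U => //.
  have UP : U *m P = U.
    have /submxP[M ->] : (U <= P)%MS.
      by rewrite (eqmx_schmidt_free (row_base_free P)) eq_row_base.
    by rewrite -mulmxA PP.
  rewrite -[in U^t*]UP trmx_mul map_mxM Ph -{1}UP.
  rewrite !mulmxA -(mulmxA U P A) -(mulmxA U (P *m A) P) PAP.
  by rewrite -scalemxAr -scalemxAl UP (unitarymxP Uu) scalemx1.
exists (U^t* *m U); split.
- split; first by rewrite mulmxA mulmxtVK.
  by rewrite trmx_mul map_mxM trmxCK.
- apply/eqP; rewrite eqn_leq; apply/andP; split.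
    by rewrite (leq_trans (mxrankM_maxr _ _)) ?mxrank_unitary.
  have := mxrankM_maxr U (U^t* *m U).
  by rewrite mulmxA (unitarymxP Uu) mul1mx mxrank_unitary.
rewrite !mulmxA -(mulmxA _ U A) -(mulmxA _ (U *m A) _) UAU.
by rewrite mul_mx_scalar -scalemxAl.
Qed.

Lemma entryE n (A : 'M[C]_n) (i j : 'I_n) : entry A i j = A i j.
Proof. by rewrite /entry !valK. Qed.

Lemma entry_ord n (A : 'M[C]_n) p q (hp : (p < n)%N) (hq : (q < n)%N) :
  entry A p q = A (Ordinal hp) (Ordinal hq).
Proof. exact: (entryE A (Ordinal hp) (Ordinal hq)). Qed.

Lemma entry_tridiagonal n (A : 'M[C]_n) p q :
  tridiagonal A -> (p.+1 < q)%N || (q.+1 < p)%N -> entry A p q = 0.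
Proof.
move=> At pq; rewrite /entry; case: insubP => // i _ ip; case: insubP => // j _ jq.
by rewrite At // ip jq.
Qed.

Lemma det_entry n (A : 'M[C]_n) : \det A = \det (\matrix_(i < n, j < n) entry A i j).
Proof. by congr (\det _); apply/matrixP=> i j; rewrite mxE entryE. Qed.

End RankRange.

Section Reciprocal.
Variables (R : realType) (m : nat).
Local Notation C := R[i].
Local Notation n := m.*2.+1.

(** All that the proof uses about [A], with the two means as real numbers; since indices start at 0,
    [A1] sits at the even positions. *)
Definition recip_data (A : 'M[C]_n) (a : C) (A1 A2 : R) :=
  [/\ tridiagonal A, forall i, A i i = a,
      forall i j : 'I_n, j = i.+1 :> nat -> A i j * A j i = 1 &
      forall i j : 'I_n, j = i.+1 :> nat ->
        `|A i j| ^+ 2 + `|A j i| ^+ 2 = (2 * (if odd i then A2 else A1))%:C%C].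

Variables (A : 'M[C]_n) (a : C) (A1 A2 : R).
Hypothesis A_data : recip_data A a A1 A2.

Definition centered : 'M[C]_n := A - a%:M.

(** For opposite entries b, b' of [A] the pencil has the product (al b + be conj(b')) (al b' + be
    conj(b)). Reciprocity fixes b b', and the mean fixes |b|^2 + |b'|^2, so no other information on
    [A] enters. *)
Lemma det_pencil (al be d : C) :
  \det (al *: centered + be *: centered^t* + d%:M) =
  let X := al ^+ 2 + be ^+ 2 + 2 * al * be * A1%:C%C in
  let Y := al ^+ 2 + be ^+ 2 + 2 * al * be * A2%:C%C in
  d * continuant (d ^+ 2 - X - Y) (X * Y) m.
Proof.
have [A_tridiag A_diag A_recip A_mean] := A_data.
cbv zeta; set M := (M in \det M); set X := (X in _ - X - _); set Y := (Y in _ - X - Y).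
have ME i j : M i j = al * (A i j - a *+ (i == j)) + be * (A j i - a *+ (j == i))^*
    + d *+ (i == j) by rewrite !mxE.
have M_tri : tridiagonal M.
  move=> i j ij; rewrite ME !A_tridiag ?(orbC (j.+1 < i)%N) //.
  have -> : (i == j) = false by apply/eqP=> E; move: ij; rewrite E; clear; lia.
  have -> : (j == i) = false by apply/eqP=> E; move: ij; rewrite E; clear; lia.
  by rewrite !mulr0n subr0 conjC0 !mulr0 !addr0.
rewrite det_entry (@det_tridiag_periodic _ _ _ d X Y) //.
- by move=> i j; exact: entry_tridiagonal.
- move=> i im0; have im : (i < n)%N by [].
  rewrite (entry_ord _ im im) ME !eqxx A_diag !mulr1n subrr conjC0.
  by rewrite !mulr0 !add0r.
move=> i im0; have im1 : (i < n)%N by apply: ltnW; rewrite ltnS.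
have im : (i.+1 < n)%N by [].
rewrite (entry_ord _ im1 im) (entry_ord _ im im1) !ME.
set i0 := Ordinal im1; set i1 := Ordinal im.
have -> : (i0 == i1) = false by rewrite -val_eqE /=; clear; lia.
have -> : (i1 == i0) = false by rewrite -val_eqE /=; clear; lia.
rewrite !mulr0n !subr0 !addr0.
have r1 : A i0 i1 * A i1 i0 = 1 by rewrite A_recip.
have r2 : (A i0 i1)^* * (A i1 i0)^* = 1 by rewrite -rmorphM r1 rmorph1.
have := @A_mean i0 i1 erefl; rewrite !normCK /= => mean.
transitivity (al ^+ 2 * (A i0 i1 * A i1 i0) + be ^+ 2 * ((A i0 i1)^* * (A i1 i0)^*)
    + al * be * (A i0 i1 * (A i0 i1)^* + A i1 i0 * (A i1 i0)^*)); first by ring.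
rewrite r1 r2 mean !mulr1 rmorphM rmorph_nat /X /Y.
by case: (odd i); ring.
Qed.

End Reciprocal.

Lemma horner_inj (F : numDomainType) (p q : {poly F}) :
  (forall x, p.[x] = q.[x]) -> p = q.
Proof.
move=> pq; apply/eqP; rewrite -subr_eq0; apply/eqP.
have [//|pq0] := eqVneq (p - q) 0.
have := @max_poly_roots _ (p - q) [seq i%:R | i <- iota 0 (size (p - q))] pq0.
rewrite size_map size_iota ltnn => H; suff: false by [].
apply: H; last by rewrite map_inj_uniq ?iota_uniq //; exact: (mulrIn (oner_neq0 _)).
by apply/allP=> x _; rewrite /root hornerD hornerN pq subrr.
Qed.

(** * The outer bound for the range *)

Section UpperBound.
Variables (R : realType) (m : nat).
Local Notation C := R[i].
Local Notation n := m.*2.+1.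

Definition sq_level (A1 A2 : R) (k : nat) (c : R) : R :=
  (A1 + A2) / 2 + c + kappa R m k * Num.sqrt ((A1 + c) * (A2 + c)).

Lemma sq_level_le (A1 A2 : R) k j c : (j <= k <= m)%N -> sq_level A1 A2 k c <= sq_level A1 A2 j c.
Proof.
move=> /andP[jk km]; rewrite lerD2l ler_wpM2r ?sqrtr_ge0 ?kappa_le //; lia.
Qed.

Variables (A : 'M[C]_n) (a : C) (A1 A2 : R).
Hypothesis A_data : recip_data A a A1 A2.
Hypothesis A1_ge1 : 1 <= A1.
Hypothesis A2_ge1 : 1 <= A2.

Lemma sq_level_ge0 k (c : R) : (0 < k <= m)%N -> -1 <= c -> 0 <= sq_level A1 A2 k c.
Proof.
have A1g := A1_ge1; have A2g := A2_ge1.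
move=> km c1; have /andP[k1 k2] := kappa_bounds R km.
rewrite /sq_level; set w := Num.sqrt _.
have w0 : 0 <= w by exact: sqrtr_ge0.
have : w ^+ 2 = (A1 + c) * (A2 + c) by rewrite sqr_sqrtr // mulr_ge0 //; lra.
have w1 : w <= (A1 + A2) / 2 + c.
  rewrite -(@ler_pXn2r _ 2) ?nnegrE //; last by lra.
  rewrite sqr_sqrtr; last by rewrite mulr_ge0 //; lra.
  have := sqr_ge0 (A1 - A2); nra.
move=> _; nra.
Qed.

(** This is Re (e^(i theta) (A - a)) for p + i q = e^(i theta); accordingly [p ^+ 2 - q ^+ 2] stands
    for cos (2 theta) throughout. *)
Definition real_part (p q : R) : 'M[C]_n :=
  ((p +i* q) / 2)%C *: centered A a + ((p -i* q) / 2)%C *: (centered A a)^t*.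

(** In [det_pencil] the product X Y becomes the square of w / 2, so the continuant splits into the
    factors s^2 - F_j, each of which is a difference of squares. *)
Lemma char_poly_real_part (p q : R) : p ^+ 2 + q ^+ 2 = 1 ->
  let rt j := Num.sqrt (sq_level A1 A2 j (p ^+ 2 - q ^+ 2)) in
  char_poly (real_part p q) =
  \prod_(r <- 0 :: [seq (rt j.+1)%:C%C | j <- iota 0 m] ++
               [seq (- rt j.+1)%:C%C | j <- iota 0 m]) ('X - r%:P).
Proof.
have A1g := A1_ge1; have A2g := A2_ge1.
move=> pq1 rt; apply: horner_inj => s.
rewrite horner_char_poly big_cons big_cat /= !big_map.
have -> : iota 0 m = index_iota 0 m by rewrite /index_iota subn0.
rewrite !big_mkord.
rewrite hornerM hornerXsubC subr0 hornerM !horner_prod.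
rewrite (_ : s%:M - _ = (- ((p +i* q) / 2)%C) *: centered A a +
   (- ((p -i* q) / 2)%C) *: (centered A a)^t* + s%:M); last first.
  by rewrite /real_part !scaleNr opprD addrC.
rewrite (det_pencil A_data); cbv zeta.
set c := p ^+ 2 - q ^+ 2 in rt *.
have c1 : -1 <= c by rewrite /c; nra.
set w := Num.sqrt ((A1 + c) * (A2 + c)).
have w2 : w ^+ 2 = (A1 + c) * (A2 + c) by rewrite sqr_sqrtr // mulr_ge0 //; lra.
have z2 : (p +i* q)%C ^+ 2 + (p -i* q)%C ^+ 2 = (2 * c)%:C%C.
  by apply/eqP; rewrite eq_complex /=; apply/andP; split; apply/eqP; rewrite /c; ring.
have zz : (p +i* q)%C * (p -i* q)%C = 1.
  by apply/eqP; rewrite eq_complex /=; apply/andP; split; apply/eqP; [rewrite -pq1|]; ring.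
have XYE (B : R) : (- ((p +i* q)%C / 2)) ^+ 2 + (- ((p -i* q)%C / 2)) ^+ 2 +
    2 * - ((p +i* q)%C / 2) * - ((p -i* q)%C / 2) * B%:C%C = ((B + c) / 2)%:C%C.
  transitivity (((p +i* q)%C ^+ 2 + (p -i* q)%C ^+ 2) / 4 +
    ((p +i* q)%C * (p -i* q)%C) * B%:C%C / 2); first by field.
  rewrite z2 zz mul1r !rmorphM /= !rmorphD /= !fmorphV /= !rmorph_nat. by field.
rewrite !XYE.
have -> : ((A1 + c) / 2)%:C%C * ((A2 + c) / 2)%:C%C = (w / 2)%:C%C ^+ 2.
  by rewrite -rmorphM -rmorphXn expr_div_n w2; congr (_%:C%C); field.
rewrite (continuant_sqr_factor (real_complex R)) -big_split /=; congr (s * _).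
apply: eq_bigr => j _; rewrite !hornerXsubC.
have rt2 : rt j.+1 ^+ 2 = (A1 + c) / 2 + (A2 + c) / 2 + 2 * kappa R m j.+1 * (w / 2).
  rewrite sqr_sqrtr; last by rewrite sq_level_ge0 // ltn_ord.
  by rewrite /sq_level -/w; field.
rewrite rmorphN /= opprK -subr_sqr -rmorphXn rt2 !rmorphD -rmorphM /=.
by rewrite opprD opprD !addrA.
Qed.

(** F_j decreases in j, so only the k - 1 nonnegative roots of smaller index can exceed the one of
    index [k]. *)
Lemma count_level_gt (k : nat) (c : R)
    (rt := fun j => Num.sqrt (sq_level A1 A2 j c)) : (0 < k <= m)%N ->
  (count (fun r : C => ~~ (r <= (rt k)%:C%C)%R)
     (0%R :: [seq (rt j.+1)%:C%C | j <- iota 0 m] ++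
        [seq (- rt j.+1)%R%:C%C | j <- iota 0 m]) < k)%N.
Proof.
move=> /andP[k0 km]; rewrite /= count_cat !count_map /=.
rewrite lecR sqrtr_ge0 add0n.
rewrite [X in (_ + X)%N](_ : _ = 0%N) ?addn0; last first.
  apply/eqP; rewrite -leqn0 leqNgt -has_count; apply/hasPn=> j _ /=.
  by rewrite negbK lecR (le_trans _ (sqrtr_ge0 _)) // oppr_le0 sqrtr_ge0.
apply: (@leq_ltn_trans (count (fun j => (j < k.-1)%N) (iota 0 m))).
  rewrite -!size_filter; apply: uniq_leq_size => [|j].
    by rewrite filter_uniq ?iota_uniq.
  rewrite !mem_filter mem_iota add0n => /andP[jk /andP[_ jm]].
  rewrite jm !andbT; apply: contraNltn jk => kj.
  by rewrite lecR ler_wsqrtr // sq_level_le //; lia.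
suff cnt i : (count (fun j => (j < k.-1)%N) (iota i m) <= k.-1 - i)%N.
  by apply: leq_ltn_trans (cnt 0) _; clear -k0; lia.
elim: m i => // l IH i /=; have := IH i.+1.
set x := count _ _; case: (ltnP i k.-1) => ik; lia.
Qed.

(** Interlacing bounds Re (e^(i theta) (z - a)) from above; theta + pi, which has the same cos (2
    theta), bounds its opposite, hence the square. *)
Lemma rank_num_range_le k z (p q : R) : (0 < k <= m)%N ->
  p ^+ 2 + q ^+ 2 = 1 -> rank_num_range k A z ->
  (p * complex.Re (z - a) - q * complex.Im (z - a)) ^+ 2
    <= sq_level A1 A2 k (p ^+ 2 - q ^+ 2).
Proof.
have A1g := A1_ge1; have A2g := A2_ge1.
move=> km pq1 /rank_num_rangeP[U Uu UA].
have UAc : U *m centered A a *m U^t* = (z - a)%:M.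
  rewrite mulmxBr mulmxBl UA mul_mx_scalar -scalemxAl (unitarymxP Uu).
  by rewrite scalemx1 -raddfB.
have UAc' : U *m (centered A a)^t* *m U^t* = ((z - a)^*)%:M.
  have -> : U *m (centered A a)^t* *m U^t* = (U *m centered A a *m U^t*)^t*.
    by rewrite !trmx_mul !map_mxM trmxCK mulmxA.
  by rewrite UAc tr_scalar_mx map_scalar_mx.
have c1 : -1 <= p ^+ 2 - q ^+ 2 by nra.
have L0 := sq_level_ge0 km c1.
have UB (p' q' : R) : p' ^+ 2 + q' ^+ 2 = 1 -> p' ^+ 2 - q' ^+ 2 = p ^+ 2 - q ^+ 2 ->
    p' * complex.Re (z - a) - q' * complex.Im (z - a)
      <= Num.sqrt (sq_level A1 A2 k (p ^+ 2 - q ^+ 2)).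
  move=> pq1' cE; rewrite -lecR.
  apply: (@hermitian_compression_le _ _ _ (real_part p' q') _ U
    _ _ _ (char_poly_real_part pq1') _ Uu).
  - rewrite /real_part; apply/matrixP=> i j; rewrite !mxE.
    have zc : ((p' +i* q')%C / 2)^* = (p' -i* q')%C / 2.
      by rewrite fmorph_div rmorph_nat.
    rewrite -zc; move: ((p' +i* q')%C / 2) => u.
    by rewrite rmorphD !rmorphM /= !conjCK [LHS]addrC.
  - by rewrite cE; exact: count_level_gt.
  - rewrite /real_part mulmxDr -!scalemxAr mulmxDl -!scalemxAl UAc UAc'.
    rewrite !scale_scalar_mx -raddfD /=; congr (_%:M).
    case: (z - a) => x y; apply/eqP; rewrite eq_complex /=.
    by apply/andP; split; apply/eqP; field.
rewrite -[X in _ <= X]sqr_sqrtr // -[X in X <= _]real_normK ?num_real //.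
rewrite ler_pXn2r ?nnegrE ?sqrtr_ge0 // ler_norml UB // andbT.
rewrite lerNl; have := UB (- p) (- q); rewrite !sqrrN => /(_ pq1 erefl).
by rewrite !mulNr opprB opprK addrC.
Qed.

End UpperBound.

(** * Roots of self-inversive polynomials *)

Section RootCount.
Variable C : numClosedFieldType.

Definition disc_roots (p : {poly C}) : nat :=
  count (fun r => `|r| < 1) (sval (closed_field_poly_normal p)).

Lemma disc_rootsE (p : {poly C}) c rs : p != 0 ->
  p = c *: \prod_(r <- rs) ('X - r%:P) ->
  disc_roots p = count (fun r => `|r| < 1) rs.
Proof.
move=> p0 pE; rewrite /disc_roots; case: closed_field_poly_normal => s /= ps.
apply/permP/prod_XsubC_eq.
have lc : lead_coef p = c.
  by rewrite pE lead_coefZ lead_coef_prod_XsubC mulr1.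
apply: (@scalerI _ _ (lead_coef p)); first by rewrite lead_coef_eq0.
by rewrite -ps lc.
Qed.

Lemma disc_rootsM (p q : {poly C}) : p != 0 -> q != 0 ->
  disc_roots (p * q) = (disc_roots p + disc_roots q)%N.
Proof.
move=> p0 q0; have [rp pE] := closed_field_poly_normal p.
have [rq qE] := closed_field_poly_normal q.
rewrite (disc_rootsE p0 pE) (disc_rootsE q0 qE) -count_cat.
apply: (@disc_rootsE _ (lead_coef p * lead_coef q)); first by rewrite mulf_neq0.
by rewrite big_cat /= {1}pE {1}qE -scalerAl -scalerAr scalerA.
Qed.

Lemma disc_rootsZ c (p : {poly C}) : c != 0 -> p != 0 ->
  disc_roots (c *: p) = disc_roots p.
Proof.
move=> c0 p0; have [rp pE] := closed_field_poly_normal p.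
rewrite (disc_rootsE p0 pE); apply: (@disc_rootsE _ (c * lead_coef p)).
  by rewrite scale_poly_eq0 negb_or c0.
by rewrite {1}pE scalerA.
Qed.

Lemma disc_roots_prod (I : Type) (s : seq I) (f : I -> {poly C}) :
  (forall i, f i != 0) ->
  disc_roots (\prod_(i <- s) f i) = (\sum_(i <- s) disc_roots (f i))%N.
Proof.
move=> f0; suff [] : \prod_(i <- s) f i != 0 /\
  disc_roots (\prod_(i <- s) f i) = (\sum_(i <- s) disc_roots (f i))%N by [].
elim: s => [|i s [IH0 IH]].
  rewrite !big_nil oner_neq0 (@disc_rootsE _ 1 [::]) ?oner_neq0 //.
  by rewrite big_nil scale1r.
by rewrite !big_cons disc_rootsM ?IH ?mulf_neq0.
Qed.

Section SelfInversive.
Variables (d : nat) (p : {poly C}).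
Hypothesis size_p : size p = d.+1.
Hypothesis p_root0 : ~~ root p 0.
Hypothesis p_inv : forall x, x != 0 -> p.[x] = x ^+ d * (p.[(x^-1)^*])^*.

(** [p_inv] says that [p] equals its conjugate reciprocal polynomial, whose roots are the
    reflections of the roots of [p] in the unit circle. *)
Lemma self_inversive_roots rs :
  p = lead_coef p *: \prod_(r <- rs) ('X - r%:P) ->
  perm_eq rs [seq (r^-1)^* | r <- rs].
Proof.
move=> pE; have p0 : p != 0 by rewrite -size_poly_eq0 size_p.
have lc0 : lead_coef p != 0 by rewrite lead_coef_eq0.
have srs : size rs = d.
  have := size_p; rewrite {1}pE size_scale // size_prod_XsubC.
  by case.
have rs0 r : r \in rs -> r != 0.
  move=> rrs; apply: contraNneq p_root0 => <-.
  by rewrite pE rootZ // root_prod_XsubC.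
pose c := (lead_coef p)^* / lead_coef p * \prod_(r <- rs) (- r^*).
(* The factor ['X] makes the identity trivial at 0, where [p_inv] gives nothing. *)
have E : 'X * \prod_(r <- rs) ('X - r%:P) =
    'X * (c *: \prod_(r <- [seq (r^-1)^* | r <- rs]) ('X - r%:P)).
  apply: horner_inj => x; rewrite !hornerM hornerX.
  have [->|x0] := eqVneq x 0; first by rewrite !mul0r.
  congr (x * _); rewrite hornerZ !horner_prod big_map.
  have pr : x ^+ size rs * (\prod_(r <- rs) ((x^-1)^* - r))^* =
      \prod_(r <- rs) (- r^*) * \prod_(r <- rs) (x - (r^-1)^*).
    elim: rs rs0 {pE srs c} => [|r rs IH] rs0; first by rewrite !big_nil conjC1 !mul1r.
    rewrite !big_cons rmorphM /= exprS mulrACA IH => [|s ss]; last first.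
      by rewrite rs0 // inE ss orbT.
    rewrite [RHS]mulrACA; congr (_ * _).
    rewrite rmorphB /= conjCK fmorphV /= mulrBr mulfV // mulrBr.
    rewrite [- r^* * (r^*)^-1]mulNr mulfV ?conjC_eq0 ?rs0 ?mem_head //.
    by rewrite opprK addrC mulNr mulrC.
  apply: (mulfI lc0); have := p_inv x0.
  rewrite {1 2}pE !hornerZ !horner_prod rmorphM /= -srs.
  under eq_bigr do rewrite hornerXsubC.
  under [in X in _ = X -> _]eq_bigr do rewrite hornerXsubC.
  under [in X in _ -> _ = X]eq_bigr do rewrite hornerXsubC.
  move=> ->; rewrite mulrCA pr /c.
  by field.
have EE := mulfI (negbT (polyX_eq0 C)) E.
have c1 : c = 1.
  have /(congr1 lead_coef) := EE.
  by rewrite lead_coefZ !lead_coef_prod_XsubC mulr1.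
by apply: prod_XsubC_eq; rewrite EE c1 scale1r.
Qed.

(** Reflection in the unit circle matches the roots inside with the roots outside, multiplicities
    included. *)
Lemma self_inversive_disc :
  ((0 < d)%N -> (exists2 r, root p r & `|r| != 1) -> (0 < disc_roots p)%N) /\
  ((forall r, root p r -> `|r| != 1) -> (disc_roots p).*2 = d).
Proof.
have p0 : p != 0 by rewrite -size_poly_eq0 size_p.
have lc0 : lead_coef p != 0 by rewrite lead_coef_eq0.
have [rs pE] := closed_field_poly_normal p.
have prs r : root p r = (r \in rs) by rewrite {1}pE rootZ // root_prod_XsubC.
have rs0 r : r \in rs -> 0 < `|r|.
  by move=> rrs; rewrite normr_gt0; apply: contraNneq p_root0 => <-; rewrite prs.
have srs : size rs = d.
  by have := size_p; rewrite {1}pE size_scale // size_prod_XsubC => -[].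
have in_out : count (fun r => `|r| < 1) rs = count (fun r => 1 < `|r|) rs.
  rewrite (permP (self_inversive_roots pE)) count_map.
  apply: eq_in_count => r rrs /=.
  by rewrite norm_conjC normfV invf_lt1 ?rs0.
rewrite (disc_rootsE p0 pE); split.
  move=> _ [r]; rewrite prs => rrs; rewrite real_neqr_lt ?normr_real ?real1 //.
  case/orP => r1; first by rewrite -has_count; apply/hasP; exists r.
  by rewrite in_out -has_count; apply/hasP; exists r.
move=> r1; rewrite -addnn {2}in_out -srs -(count_predC (fun r => `|r| < 1) rs).
congr (_ + _)%N; apply: eq_in_count => r rrs /=.
have : `|r| != 1 by rewrite r1 ?prs.
rewrite real_neqr_lt ?normr_real ?real1 // => /orP[] h.
  by rewrite h lt_gtF.
by rewrite h (lt_gtF h).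
Qed.
End SelfInversive.
End RootCount.

(** * The quartic factors of the pencil determinant *)

Section Quartic.
Variables (R : realType) (A1 A2 : R).
Local Notation C := R[i].

(** The factor that [continuant_sqr] attaches to [kap], as a polynomial in the pencil parameter.
    Explicit coefficients make its degree and its value at 0 visible; [horner_quartic] is the usable
    form. *)
Definition quartic (kap : R) (z : C) : {poly C} :=
  let l2 := z ^+ 2 - 2 in
  let l1 := 2 * z * z^* - 2 * (A1 + A2)%:C%C in
  let e := (4 * kap ^+ 2)%:C%C in
  let a3 := 2 * l2 * l1 - e * (2 * (A1 + A2))%:C%C in
  Poly [:: (l2 ^+ 2 - e)^*; a3^*;
    l1 ^+ 2 + 2 * l2 * l2^* - e * (2 + 4 * A1 * A2)%:C%C; a3; l2 ^+ 2 - e].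

Lemma horner_quartic kap z x :
  (quartic kap z).[x] =
  let X := x ^+ 2 + 1 + 2 * x * A1%:C%C in
  let Y := x ^+ 2 + 1 + 2 * x * A2%:C%C in
  ((x * z + z^*) ^+ 2 - X - Y) ^+ 2 - (4 * kap ^+ 2)%:C%C * (X * Y).
Proof.
have cr (r : R) : (r%:C%C)^* = r%:C%C :> C by exact: conjc_real.
rewrite /quartic horner_Poly /= !(rmorphB, rmorphM, rmorphD, rmorphXn, rmorph_nat) /=.
rewrite !cr !conjCK; ring.
Qed.

Lemma quartic_inv kap z x : x != 0 ->
  (quartic kap z).[x] = x ^+ 4 * ((quartic kap z).[(x^-1)^*])^*.
Proof.
move=> x0; have cr (r : R) : (r%:C%C)^* = r%:C%C :> C by exact: conjc_real.
rewrite !horner_quartic /=.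
rewrite !(rmorphB, rmorphM, rmorphD, rmorphXn, rmorph_nat, rmorph1) /= !cr !conjCK.
by field.
Qed.

Lemma size_quartic kap z : (z ^+ 2 - 2) ^+ 2 != (4 * kap ^+ 2)%:C%C ->
  size (quartic kap z) = 5 /\ ~~ root (quartic kap z) 0.
Proof.
rewrite -subr_eq0 => l0; split; first by rewrite /quartic (PolyK (c := 0)).
rewrite /root /quartic horner_Poly /= mul0r !add0r mulr0 add0r.
by rewrite conjC_eq0.
Qed.

(* On the unit circle, the quartic of index j factors through the squared levels j and m.+1 - j. *)
Lemma horner_quartic_unit kap (x y p q : R) :
  p ^+ 2 + q ^+ 2 = 1 ->
  let c := p ^+ 2 - q ^+ 2 in
  (quartic kap (x +i* y)%C).[(p +i* q)%C ^+ 2] =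
  16 * (p +i* q)%C ^+ 4 *
  (((p * x - q * y) ^+ 2 - ((A1 + A2) / 2 + c)) ^+ 2
     - kap ^+ 2 * ((A1 + c) * (A2 + c)))%:C%C.
Proof.
move=> pq1 c; rewrite horner_quartic /=.
set u := (p +i* q)%C; set v := (p -i* q)%C; set z := (x +i* y)%C.
have uv : u * v = 1.
  by apply/eqP; rewrite eq_complex /=; apply/andP; split; apply/eqP; [rewrite -pq1|]; ring.
have u2 : u ^+ 2 + v ^+ 2 = (2 * c)%:C%C.
  by apply/eqP; rewrite eq_complex /=; apply/andP; split; apply/eqP; rewrite /c; ring.
have t2 : u * z + v * z^* = (2 * (p * x - q * y))%:C%C.
  by apply/eqP; rewrite eq_complex /=; apply/andP; split; apply/eqP; ring.
have -> : u ^+ 2 * z + z^* = u * (2 * (p * x - q * y))%:C%C.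
  by rewrite -t2 mulrDr !mulrA uv mul1r -expr2.
have XE (B : R) : (u ^+ 2) ^+ 2 + 1 + 2 * u ^+ 2 * B%:C%C = u ^+ 2 * (2 * (B + c))%:C%C.
  have -> : (2 * (B + c))%:C%C = 2 * B%:C%C + (u ^+ 2 + v ^+ 2).
    by rewrite u2; apply/eqP; rewrite eq_complex /=; apply/andP; split; apply/eqP; ring.
  transitivity ((u ^+ 2) ^+ 2 + (u * v) ^+ 2 + 2 * u ^+ 2 * B%:C%C); last by ring.
  by rewrite uv expr1n.
rewrite !XE !(rmorphB, rmorphM, rmorphD, rmorphXn, rmorph_nat, fmorphV) /=.
by field.
Qed.

(** Otherwise z^2 - 2 would be 2 kap or - 2 kap, whereas the imaginary part of z^2 is 2 x y. *)
Lemma nonreal_sqr_neq kap (x y : R) : x * y != 0 ->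
  ((x +i* y)%C ^+ 2 - 2) ^+ 2 != (4 * kap ^+ 2)%:C%C.
Proof.
move=> xy0; apply/eqP => E.
have E0 : (((x +i* y)%C ^+ 2 - 2) - (2 * kap)%:C%C) * (((x +i* y)%C ^+ 2 - 2) + (2 * kap)%:C%C) = 0.
  by rewrite -subr_sqr E -rmorphXn /=; apply/eqP; rewrite subr_eq0; apply/eqP; congr (_%:C%C); ring.
move/eqP: E0; rewrite mulf_eq0 => /orP[] /eqP/(congr1 (@complex.Im R)) /= E1;
  apply: (negP xy0); apply/eqP; lra.
Qed.

End Quartic.

(** * Points strictly below the bound *)

Section Existence.
Variables (R : realType) (m : nat).
Local Notation C := R[i].
Local Notation n := m.*2.+1.
Variables (A : 'M[C]_n) (a : C) (A1 A2 : R).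
Hypothesis A_data : recip_data A a A1 A2.
Hypothesis A1_ge1 : 1 <= A1.
Hypothesis A2_ge1 : 1 <= A2.

Variables (x y : R) (k : nat).
Hypothesis km : (0 < k <= m)%N.
Hypothesis xy0 : x * y != 0.
Hypothesis z_below : forall p q : R, p ^+ 2 + q ^+ 2 = 1 ->
  (p * x - q * y) ^+ 2 < sq_level m A1 A2 k (p ^+ 2 - q ^+ 2).
(** Here j <= k < m + 1 - j: the strict bound excludes unimodular roots coming from level j but not
    from level m + 1 - j, so a root off the circle has to be supplied separately. *)
Hypothesis z_nonunit : forall j, (0 < j <= k)%N -> (k + j < m.+1)%N ->
  exists2 r, root (quartic A1 A2 (kappa R m j) (x +i* y)%C) r & `|r| != 1.

Let z := (x +i* y)%C.
Let Q j := quartic A1 A2 (kappa R m j) z.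

Lemma quartic_rev j : (j <= m.+1)%N -> Q (m.+1 - j) = Q j.
Proof.
by move=> jm; rewrite /Q /quartic kappa_rev // sqrrN.
Qed.

Lemma unit_complex_sqr (u : C) : `|u| = 1 ->
  exists p q : R, p ^+ 2 + q ^+ 2 = 1 /\ u = (p +i* q)%C ^+ 2.
Proof.
move=> u1; exists (complex.Re (sqrtC u)), (complex.Im (sqrtC u)).
have E : `|sqrtC u| = 1.
  by apply: (@pexpIrn _ 2); rewrite ?nnegrE ?ler01 // -normrX sqrtCK u1 expr1n.
split.
  by apply/complexI; rewrite add_Re2_Im2 E expr1n.
by rewrite -[LHS](sqrtCK u); case: (sqrtC u).
Qed.

(** A root e^(2 i theta) would make (p x - q y)^2 equal to F_j or F_(m+1-j) at cos (2 theta). Both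
    are at least F_k there, against [z_below]. *)
Lemma quartic_no_unit_root j r : (0 < j <= m)%N -> root (Q j) r -> `|r| = 1 ->
  (j <= k)%N -> (m.+1 - j <= k)%N -> False.
Proof.
have A1g := A1_ge1; have A2g := A2_ge1.
move=> /andP[j0 jm] Qr /unit_complex_sqr[p [q [pq1 rE]]] jk jk'.
move: Qr; rewrite /root rE horner_quartic_unit //= mulf_eq0 => /orP[].
  rewrite mulf_eq0 pnatr_eq0 /= expf_eq0 /= => /eqP E.
  by have := pq1; case: E => -> ->; rewrite expr0n /= addr0 => /eqP; rewrite eq_sym oner_eq0.
set c := p ^+ 2 - q ^+ 2; have c1 : -1 <= c by rewrite /c; nra.
have km' : (k <= m)%N by case/andP: km.
have l1 := @sq_level_le _ m A1 A2 k j c; have l2 := @sq_level_le _ m A1 A2 k (m.+1 - j) c.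
have zb := z_below pq1; move: zb l1 l2; rewrite /sq_level -/c kappa_rev; last by lia.
set w := Num.sqrt _.
have w2 : w ^+ 2 = (A1 + c) * (A2 + c) by rewrite sqr_sqrtr // mulr_ge0 //; lra.
rewrite -w2 jk km' jk' => zb /(_ isT) l1 /(_ isT) l2.
move=> /eqP/(congr1 (@complex.Re R)) /= E.
have : ((p * x - q * y) ^+ 2 - ((A1 + A2) / 2 + c) - kappa R m j * w) *
  ((p * x - q * y) ^+ 2 - ((A1 + A2) / 2 + c) + kappa R m j * w) = 0.
  by rewrite -subr_sqr exprMn.
by move=> /eqP; rewrite mulf_eq0 => /orP[] /eqP; lra.
Qed.

Lemma quartic_neq0 j : Q j != 0.
Proof.
have [sQ _] := size_quartic A1 A2 (nonreal_sqr_neq (kappa R m j) xy0).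
by rewrite -size_poly_eq0 sQ.
Qed.

(** If both indices of the pair are at most [k], no root is unimodular and two of the four lie in
    the disk. If just one is, [z_nonunit] provides a root off the circle, hence one in the disk. *)
Lemma disc_roots_quartic j : (0 < j <= m)%N ->
  ((j <= k) + (m.+1 - j <= k) <= disc_roots (Q j))%N.
Proof.
move=> /andP[j0 jm].
have [sQ Q0] := size_quartic A1 A2 (nonreal_sqr_neq (kappa R m j) xy0).
have [d1 d2] := self_inversive_disc sQ Q0 (@quartic_inv R A1 A2 (kappa R m j) z).
have [jk|jk] := leqP j k; have [jk'|jk'] := leqP (m.+1 - j) k; rewrite //.
- have : (disc_roots (Q j)).*2 = 4%N.
    by apply: d2 => r Qr; apply/eqP => r1; apply: (@quartic_no_unit_root j r); rewrite ?j0.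
  by clear; lia.
- by apply: d1 => //; apply: z_nonunit; lia.
- apply: d1 => //; rewrite -/z -/(Q j) -quartic_rev ?leqW //; apply: z_nonunit; lia.
Qed.

Lemma sum_ltn_ord l k' : (k' <= l)%N -> (\sum_(j < l) (j < k') = k')%N.
Proof.
move=> kl; rewrite -[RHS]muln1 -{2}[k']card_ord -sum_nat_const.
rewrite (big_ord_widen l (fun=> 1%N)) // [RHS]big_mkcond.
by apply: eq_bigr => j _; case: ltnP.
Qed.

Let B := centered A a - z%:M.

Lemma det_centered_sub_neq0 : \det B != 0.
Proof.
have -> : B = 1 *: centered A a + 0 *: (centered A a)^t* + (- z)%:M.
  by rewrite scale1r scale0r addr0 raddfN.
rewrite (det_pencil A_data); cbv zeta.
rewrite !(expr1n, expr0n, mulr0, mul0r, addr0, mulr1) /= sqrrN.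
have z0 : z != 0.
  by apply: contraNneq xy0 => /eqP; rewrite eq_complex /= => /andP[/eqP-> _]; rewrite mul0r.
rewrite mulf_neq0 ?oppr_eq0 //; set K := continuant _ _ _.
suff : K ^+ 2 != 0 by rewrite expf_eq0.
rewrite /K {K}.
have -> : 1 = 1 ^+ 2 :> C by rewrite expr1n.
rewrite (continuant_sqr (real_complex R)).
apply/prodf_neq0 => j _; rewrite expr1n mulr1 subr_eq0.
have -> : z ^+ 2 - 1 - 1 = z ^+ 2 - 2 by ring.
exact: nonreal_sqr_neq.
Qed.

(** The square avoids a choice of square root of X Y; one is taken pointwise in [t] and disappears
    from the result. *)
Lemma det_isometry_pencil t :
  \det (t *: B + B^t*) ^+ 2 = (t * z + z^*) ^+ 2 * \prod_(j < m) (Q j.+1).[t].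
Proof.
have -> : t *: B + B^t* = t *: centered A a + 1 *: (centered A a)^t* + (- (t * z + z^*))%:M.
  apply/matrixP=> i j; rewrite !mxE [j == i]eq_sym !(rmorphB, rmorphMn) /=.
  by case: (i == j); rewrite ?mulr1n ?mulr0n; ring.
rewrite (det_pencil A_data); cbv zeta.
rewrite expr1n mulr1 exprMn sqrrN; set P := (P in continuant _ P _).
rewrite -(sqrtCK P) (continuant_sqr (real_complex R)).
congr (_ * _); apply: eq_bigr => j _.
by rewrite /Q horner_quartic sqrtCK.
Qed.

Lemma rank_num_range_below : rank_num_range k A (z + a).
Proof.
have /andP[k0 km'] := km.
have Bu : B \in unitmx by rewrite unitmxE unitfE det_centered_sub_neq0.
pose T := - B^t* *m invmx B.
pose lin : {poly C} := z *: 'X + (z^*)%:P.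
have z0 : z != 0.
  by apply: contraNneq xy0 => /eqP; rewrite eq_complex /= => /andP[/eqP-> _]; rewrite mul0r.
have lin0 : lin != 0.
  apply: contraNneq z0 => /(congr1 (fun p : {poly C} => p`_1)).
  by rewrite coefD coefZ coefX coefC /= mulr1 addr0 coef0 => ->.
have chi0 : char_poly T != 0 by rewrite monic_neq0 ?char_poly_monic.
have polyE : (\det B) ^+ 2 *: (char_poly T * char_poly T) =
    (lin * lin) * \prod_(j < m) Q j.+1.
  apply: horner_inj => t; rewrite hornerZ !hornerM horner_prod -expr2 -exprMn.
  rewrite horner_char_poly mulrC -det_mulmx mulmxBl mul_scalar_mx.
  rewrite /T !mulNmx opprK mulmxKV // det_isometry_pencil.
  by rewrite /lin hornerD hornerZ hornerX hornerC expr2 mulrC [z * t]mulrC mulrC.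
have kdisc : (k <= disc_roots (char_poly T))%N.
  have := congr1 (@disc_roots _) polyE.
  rewrite disc_rootsZ ?expf_neq0 ?det_centered_sub_neq0 ?mulf_neq0 //.
  rewrite [in RHS]disc_rootsM ?mulf_neq0 //; last by apply/prodf_neq0 => j _; exact: quartic_neq0.
  rewrite disc_rootsM // disc_roots_prod => [E|j]; last exact: quartic_neq0.
  have : (\sum_(j < m) ((j.+1 <= k) + (m.+1 - j.+1 <= k)) <= disc_roots (char_poly T) + disc_roots (char_poly T))%N.
    rewrite E; apply: leq_trans (leq_addl _ _); apply: leq_sum => j _.
    by apply: disc_roots_quartic; rewrite ltn_ord.
  rewrite big_split /= sum_ltn_ord //.
  rewrite (reindex_inj rev_ord_inj) /=.
  rewrite [X in (_ + X <= _)%N](eq_bigr (fun j : 'I_m => (j < k)%N : nat)).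
    by rewrite sum_ltn_ord //; clear; lia.
  by move=> j _; rewrite subSS subKn.
have [rs0 chiE] := closed_field_poly_normal (char_poly T).
rewrite (disc_rootsE chi0 chiE) in kdisc.
rewrite (monicP (char_poly_monic T)) scale1r in chiE.
pose inside := fun r : C => `|r| < 1.
(* Listing the eigenvalues of the disk first makes the flag of length [k] use only these. *)
pose rs := [seq r <- rs0 | inside r] ++ [seq r <- rs0 | ~~ inside r].
have rsE : char_poly T = \prod_(r <- rs) ('X - r%:P).
  rewrite chiE; apply: perm_big; rewrite perm_sym; exact/permPl/perm_filterC.
have kn : (k <= n)%N by clear -km'; lia.
have [V [U [Vf VT Ut Ud]]] := invariant_flag rsE kn.
have TB : T *m B *m T^t* = B.
  have -> : T^t* = - ((invmx B)^t* *m B).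
    have -> : T = - (B^t* *m invmx B) by rewrite /T mulNmx.
    rewrite -[X in _ = - (_ *m X)]trmxCK -map_mxM -trmx_mul.
    by apply/matrixP=> i j; rewrite !mxE rmorphN.
  rewrite /T !mulNmx mulmxKV // mulmxN opprK mulmxA.
  by rewrite -map_mxM -trmx_mul mulVmx // trmx1 map_mx1 mul1mx.
have VB : V *m B *m V^t* = 0.
  apply: isotropic_contraction TB VT Ut _ => i; rewrite Ud /rs nth_cat.
  have ik : (i < size [seq r <- rs0 | inside r])%N.
    by rewrite size_filter (leq_trans (ltn_ord i)).
  by rewrite ik; have := mem_nth 0 ik; rewrite mem_filter => /andP[].
have [W Wu WB] := unitary_isotropic Vf VB.
apply/rank_num_rangeP; exists W => //.
have -> : A = B + (z + a)%:M by rewrite /B /centered raddfD /= addrA subrK subrK.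
rewrite mulmxDr mulmxDl WB add0r mul_mx_scalar -scalemxAl (unitarymxP Wu).
by rewrite scalemx1.
Qed.

End Existence.

(** * Ellipses *)

Section Ellipse.
Variable R : realType.
Local Notation C := R[i].

(** The form in 2 theta attains its amplitude N where e^(2 i theta) = (g - i h) / N; p + i q is a
    square root of this number. *)
Lemma half_angle (g h : R) : exists p q : R, p ^+ 2 + q ^+ 2 = 1 /\
  (p ^+ 2 - q ^+ 2) * g - 2 * p * q * h = Num.sqrt (g ^+ 2 + h ^+ 2).
Proof.
set N := Num.sqrt _; have N2 : N ^+ 2 = g ^+ 2 + h ^+ 2.
  by rewrite sqr_sqrtr // addr_ge0 ?sqr_ge0.
have [N0|N0] := eqVneq N 0.
  exists 1, 0; split; first by rewrite expr1n expr0n addr0.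
  have g0 : g = 0.
    apply/eqP; rewrite -sqrf_eq0 eq_le sqr_ge0 andbT.
    by have := sqr_ge0 h; move: N2; rewrite N0 expr0n /=; lra.
  by rewrite N0 g0; ring.
have u1 : `|((g / N) +i* (- h / N))%C| = 1 :> C.
  rewrite normc_def /= -[RHS]/(1%:C)%C; congr (_%:C)%C.
  rewrite (_ : _ + _ = 1) ?sqrtr1 //.
  by rewrite !expr_div_n sqrrN -mulrDl -N2 divff // expf_neq0.
have [p [q [pq1 /eqP]]] := unit_complex_sqr u1.
rewrite eq_complex /= => /andP[/eqP E1 /eqP E2].
exists p, q; split => //.
have -> : p ^+ 2 - q ^+ 2 = g / N by rewrite E1; ring.
have -> : 2 * p * q = - h / N by rewrite E2; ring.
by apply: (mulfI N0); rewrite -expr2 N2; field.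
Qed.

(** With f = u + i v, the focal distances satisfy (P + M)^2 = 2 (|z|^2 + |f|^2 + |z^2 - f^2|). On
    the other side, (p x - q y)^2 - (p u - q v)^2 has maximum (|z|^2 - |f|^2 + |z^2 - f^2|) / 2 over
    the angle. Both conditions thus say |z|^2 + |f|^2 + |z^2 - f^2| <= d^2 / 2. *)
Lemma ellipse_supportP (x y u v d : R) : 0 <= d ->
  (`|(x +i* y)%C - (u +i* v)%C| + `|(x +i* y)%C + (u +i* v)%C| <= d%:C%C :> C) <->
  (forall p q, p ^+ 2 + q ^+ 2 = 1 -> (p * x - q * y) ^+ 2 <=
     d ^+ 2 / 4 - (u ^+ 2 + v ^+ 2) + (p * u - q * v) ^+ 2).
Proof.
move=> d0.
set P := Num.sqrt ((x - u) ^+ 2 + (y - v) ^+ 2).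
set M := Num.sqrt ((x + u) ^+ 2 + (y + v) ^+ 2).
rewrite !normc_def /= -/P -/M -rmorphD lecR.
have P2 : P ^+ 2 = (x - u) ^+ 2 + (y - v) ^+ 2 by rewrite sqr_sqrtr // addr_ge0 ?sqr_ge0.
have M2 : M ^+ 2 = (x + u) ^+ 2 + (y + v) ^+ 2 by rewrite sqr_sqrtr // addr_ge0 ?sqr_ge0.
have P0 : 0 <= P by exact: sqrtr_ge0.
have M0 : 0 <= M by exact: sqrtr_ge0.
pose g := x ^+ 2 - y ^+ 2 - (u ^+ 2 - v ^+ 2); pose h := 2 * (x * y - u * v).
have PM : P * M = Num.sqrt (g ^+ 2 + h ^+ 2).
  rewrite -sqrtrM ?addr_ge0 ?sqr_ge0 //; congr Num.sqrt; rewrite /g /h; ring.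
have gh0 : 0 <= g ^+ 2 + h ^+ 2 by rewrite addr_ge0 ?sqr_ge0.
have diffE p q : p ^+ 2 + q ^+ 2 = 1 -> (p * x - q * y) ^+ 2 - (p * u - q * v) ^+ 2 =
    (x ^+ 2 + y ^+ 2 - (u ^+ 2 + v ^+ 2) + ((p ^+ 2 - q ^+ 2) * g - 2 * p * q * h)) / 2.
  move=> pq1; have -> : x ^+ 2 + y ^+ 2 - (u ^+ 2 + v ^+ 2) =
    (p ^+ 2 + q ^+ 2) * (x ^+ 2 + y ^+ 2 - (u ^+ 2 + v ^+ 2)) by rewrite pq1 mul1r.
  by rewrite /g /h; field.
have -> : (P + M <= d) <-> x ^+ 2 + y ^+ 2 + (u ^+ 2 + v ^+ 2) + P * M <= d ^+ 2 / 2.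
  have -> : (P + M <= d) = ((P + M) ^+ 2 <= d ^+ 2) by rewrite ler_pXn2r ?nnegrE ?addr_ge0.
  have -> : (P + M) ^+ 2 = 2 * (x ^+ 2 + y ^+ 2 + (u ^+ 2 + v ^+ 2) + P * M).
    rewrite sqrrD P2 M2; ring.
  by split; lra.
rewrite PM; split=> [H p q pq1|H].
  have := diffE p q pq1.
  have : (p ^+ 2 - q ^+ 2) * g - 2 * p * q * h <= Num.sqrt (g ^+ 2 + h ^+ 2).
    apply: le_trans (ler_norm _) _; rewrite -sqrtr_sqr ler_sqrt //.
    have : (p ^+ 2 - q ^+ 2) ^+ 2 + (2 * p * q) ^+ 2 = 1.
      by transitivity ((p ^+ 2 + q ^+ 2) ^+ 2); [ring|rewrite pq1 expr1n].
    move: (p ^+ 2 - q ^+ 2) (2 * p * q) => c s cs1.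
    have -> : g ^+ 2 + h ^+ 2 = (c ^+ 2 + s ^+ 2) * (g ^+ 2 + h ^+ 2) by rewrite cs1 mul1r.
    rewrite -subr_ge0 (_ : _ - _ = (c * h + s * g) ^+ 2) ?sqr_ge0 //; ring.
  lra.
have [p [q [pq1 E]]] := half_angle g h.
have := H p q pq1; have := diffE p q pq1; rewrite E; lra.
Qed.

End Ellipse.

(** * The ellipse is reached at half rank *)

Section Blocks.
Variables (R : realType) (m : nat).
Local Notation C := R[i].
Local Notation n := m.*2.+1.
Variables (A : 'M[C]_n) (a : C) (A1 A2 : R).
Hypothesis A_data : recip_data A a A1 A2.
Variable k : nat.
Hypothesis mk : m.+1 = k.*2.

Let S := (A1 + A2) / 2.
Hypothesis S_gt1 : 1 < S.

Lemma sum_support3 (V : nmodType) (F : 'I_n -> V) (i0 i1 i2 : 'I_n) :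
  i0 != i1 -> i0 != i2 -> i1 != i2 ->
  (forall i, i != i0 -> i != i1 -> i != i2 -> F i = 0) ->
  \sum_i F i = F i0 + (F i1 + F i2).
Proof.
move=> i01 i02 i12 F0; rewrite (bigD1 i0) //=; congr (_ + _).
rewrite (bigD1 i1) 1?eq_sym //=; congr (_ + _).
rewrite (bigD1 i2) ?[i2 == _]eq_sym ?i02 //= big1 ?addr0 // => i /andP[/andP[? ?] ?].
exact: F0.
Qed.

(** Since n = 4 k - 1, removing the indices congruent to 3 modulo 4 leaves exactly [k] triples. *)
Lemma block_lt (l : 'I_k) t : (t < 3)%N -> (4 * l + t < n)%N.
Proof. by have := ltn_ord l; move: mk; clear; lia. Qed.

Let idx (l : 'I_k) (t : 'I_3) : 'I_n := Ordinal (block_lt l (ltn_ord t)).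

Variables (x y : R).
Hypothesis xy_in : x ^+ 2 / (S + 1) + y ^+ 2 / (S - 1) <= 1.

Let N := x ^+ 2 / (S + 1) + y ^+ 2 / (S - 1).
(** [r ^+ 2] is the larger root of s^2 - s + N / 4, which gives the vector of each block the squared
    norm r^2 + N / (4 r^2) = 1. *)
Let r := Num.sqrt ((1 + Num.sqrt (1 - N)) / 2).
(** The solution of 4 S eta + 4 conj(eta) = x + i y; the left side is the value of the form of A - a
    on the vector of a block. *)
Let eta : C := ((x / (4 * (S + 1))) +i* (y / (4 * (S - 1))))%C.
Let i0 : 'I_3 := @Ordinal 3 0 isT.
Let i1 : 'I_3 := @Ordinal 3 1 isT.
Let i2 : 'I_3 := @Ordinal 3 2 isT.

(* The adjoint of the real-linear map b |-> b * beta + b^* * beta'. *)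
Let side (b b' : C) : C := (eta * b^* + eta^* * b') / r%:C%C.

Let U : 'M[C]_(k, n) := \matrix_(l, j)
  if j == idx l i0 then side (A (idx l i0) (idx l i1)) (A (idx l i1) (idx l i0))
  else if j == idx l i1 then r%:C%C
  else if j == idx l i2 then side (A (idx l i2) (idx l i1)) (A (idx l i1) (idx l i2))
  else 0.

Lemma block_radius_gt0 : 0 < r.
Proof.
by rewrite sqrtr_gt0 divr_gt0 // ltr_pwDl // sqrtr_ge0.
Qed.

Lemma block_radius_eq : r ^+ 4 + N / 4 = r ^+ 2.
Proof.
have s0 : 0 <= Num.sqrt (1 - N) by exact: sqrtr_ge0.
have s2 : Num.sqrt (1 - N) ^+ 2 = 1 - N.
  by rewrite sqr_sqrtr // subr_ge0; exact: xy_in.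
have r2 : r ^+ 2 = (1 + Num.sqrt (1 - N)) / 2 by rewrite sqr_sqrtr //; lra.
rewrite (_ : r ^+ 4 = (r ^+ 2) ^+ 2); last by ring.
rewrite r2; nra.
Qed.

Lemma block_index_neqE (l : 'I_k) (t : 'I_3) (l' : 'I_k) (t' : 'I_3) : (4 * l + t != 4 * l' + t')%N -> (idx l t == idx l' t') = false.
Proof. by move=> h; apply/negbTE; rewrite -val_eqE. Qed.

Lemma side_value b b' (B : R) : b * b' = 1 ->
  `|b| ^+ 2 + `|b'| ^+ 2 = (2 * B)%:C%C ->
  side b b' * b + (side b b')^* * b' = (2 * B%:C%C * eta + 2 * eta^*) / r%:C%C.
Proof.
move=> bb; rewrite !normCK => mean.
have bb' : b^* * b'^* = 1 by rewrite -rmorphM bb rmorph1.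
have rr : (r%:C%C)^* = r%:C%C :> C by exact: conjc_real.
have r0 : r%:C%C != 0 :> C by rewrite fmorph_eq0 gt_eqF ?block_radius_gt0.
rewrite /side rmorphM rmorphD !rmorphM fmorphV /= rr !conjCK.
transitivity ((eta * (b * b^* + b' * b'^*) + eta^* * (b * b') * 2) / r%:C%C); first by ring.
by rewrite mean bb rmorphM rmorph_nat; congr (_ / _); ring.
Qed.

Lemma side_norm b b' (B : R) : b * b' = 1 ->
  `|b| ^+ 2 + `|b'| ^+ 2 = (2 * B)%:C%C ->
  side b b' * (side b b')^* =
  (2 * B%:C%C * (eta * eta^*) + eta ^+ 2 + (eta^*) ^+ 2) / r%:C%C ^+ 2.
Proof.
move=> bb; rewrite !normCK => mean.
have bb' : b^* * b'^* = 1 by rewrite -rmorphM bb rmorph1.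
have rr : (r%:C%C)^* = r%:C%C :> C by exact: conjc_real.
rewrite /side rmorphM rmorphD !rmorphM fmorphV /= rr !conjCK.
transitivity ((eta * eta^* * (b * b^* + b' * b'^*) + eta ^+ 2 * (b^* * b'^*)
  + (eta^*) ^+ 2 * (b * b')) / r%:C%C ^+ 2); first by rewrite invfM; ring.
by rewrite mean bb bb' rmorphM rmorph_nat; congr (_ / _); ring.
Qed.

Lemma block_vec0 l j : j != idx l i0 -> j != idx l i1 -> j != idx l i2 -> U l j = 0.
Proof. by move=> /negbTE h0 /negbTE h1 /negbTE h2; rewrite mxE h0 h1 h2. Qed.

Lemma block_index_neq l : [/\ idx l i0 != idx l i1, idx l i0 != idx l i2 & idx l i1 != idx l i2].
Proof. by split; rewrite block_index_neqE //=; lia. Qed.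

Lemma block_vec_sum (V : nmodType) l (F : 'I_n -> V) :
  (forall j, U l j = 0 -> F j = 0) ->
  \sum_j F j = F (idx l i0) + (F (idx l i1) + F (idx l i2)).
Proof.
move=> F0; have [h01 h02 h12] := block_index_neq l.
by apply: sum_support3 => // j j0 j1 j2; apply: F0; exact: block_vec0.
Qed.

Lemma block_vecE l : (U l (idx l i0) = side (A (idx l i0) (idx l i1)) (A (idx l i1) (idx l i0))) *
  (U l (idx l i1) = r%:C%C) *
  (U l (idx l i2) = side (A (idx l i2) (idx l i1)) (A (idx l i1) (idx l i2))).
Proof.
have [h01 h02 h12] := block_index_neq l.
apply: pair; [apply: pair|].
- by rewrite mxE eqxx.
- by rewrite mxE [_ == idx l i0]eq_sym (negbTE h01) eqxx.
by rewrite mxE [_ == idx l i0]eq_sym (negbTE h02) [_ == idx l i1]eq_sym (negbTE h12) eqxx.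
Qed.

Lemma block_vec_other l l' t : l != l' -> U l (idx l' t) = 0.
Proof.
rewrite -val_eqE => /= ll; have := ltn_ord t => t3.
by apply: block_vec0; rewrite block_index_neqE //=; move: ll t3; clear; lia.
Qed.

Lemma block_mean l : [/\ A (idx l i0) (idx l i1) * A (idx l i1) (idx l i0) = 1,
  A (idx l i2) (idx l i1) * A (idx l i1) (idx l i2) = 1,
  `|A (idx l i0) (idx l i1)| ^+ 2 + `|A (idx l i1) (idx l i0)| ^+ 2 = (2 * A1)%:C%C &
  `|A (idx l i2) (idx l i1)| ^+ 2 + `|A (idx l i1) (idx l i2)| ^+ 2 = (2 * A2)%:C%C].
Proof.
have [_ _ A_recip A_mean] := A_data.
have o0 : odd (4 * l + 0) = false by rewrite oddD oddM.
have o1 : odd (4 * l + 1) = true by rewrite oddD oddM.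
have e1 : (4 * l + 1 = (4 * l + 0).+1)%N by clear; lia.
have e2 : (4 * l + 2 = (4 * l + 1).+1)%N by clear; lia.
split.
- by apply: A_recip; rewrite /= e1.
- by rewrite mulrC; apply: A_recip; rewrite /= e2.
- by rewrite A_mean /= ?e1 // o0.
- by rewrite addrC A_mean /= ?e2 // -?e1 o1.
Qed.

Let rC : (r%:C%C)^* = r%:C%C :> C. Proof. exact: conjc_real. Qed.

Lemma eta_value : 4 * S%:C%C * eta + 4 * eta^* = (x +i* y)%C.
Proof.
have s1 : S + 1 != 0 by rewrite gt_eqF // addr_gt0 // (lt_trans ltr01 S_gt1).
have s2 : S - 1 != 0 by rewrite gt_eqF // subr_gt0 S_gt1.
by apply/eqP; rewrite eq_complex /=; apply/andP; split; apply/eqP; field; rewrite ?s1 ?s2.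
Qed.

Lemma eta_norm : 4 * S%:C%C * (eta * eta^*) + 2 * eta ^+ 2 + 2 * (eta^*) ^+ 2 = (N / 4)%:C%C.
Proof.
have s1 : S + 1 != 0 by rewrite gt_eqF // addr_gt0 // (lt_trans ltr01 S_gt1).
have s2 : S - 1 != 0 by rewrite gt_eqF // subr_gt0 S_gt1.
by apply/eqP; rewrite eq_complex /=; apply/andP; split; apply/eqP; rewrite /N; field; rewrite ?s1 ?s2.
Qed.

Lemma block_unitary : U \is unitarymx.
Proof.
have r0 : r%:C%C != 0 :> C by rewrite fmorph_eq0 gt_eqF ?block_radius_gt0.
apply/unitarymxP/matrixP => l l'; rewrite mxE.
rewrite (block_vec_sum (l := l)) => [|j ->]; last by rewrite mul0r.
have conjU j : (U^t*) j l' = (U l' j)^* by rewrite [LHS]mxE [(U^T) _ _]mxE.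
rewrite !conjU [RHS]mxE; have [<-|ll] := eqVneq l l'; last first.
  by rewrite ![(U l' _)]block_vec_other 1?eq_sym // !conjC0 !mulr0 !addr0.
have [bb0 bb2 mean1 mean2] := block_mean l.
rewrite !block_vecE rC (side_norm bb0 mean1) (side_norm bb2 mean2).
transitivity ((4 * S%:C%C * (eta * eta^*) + 2 * eta ^+ 2 + 2 * (eta^*) ^+ 2) / r%:C%C ^+ 2 + r%:C%C ^+ 2).
  by rewrite /S rmorphM rmorphD fmorphV rmorph_nat /=; field.
rewrite eta_norm -rmorphXn -fmorphV -rmorphM -rmorphD /= (_ : N / 4 / r ^+ 2 + r ^+ 2 = 1) //.
have r0' : r != 0 by rewrite gt_eqF ?block_radius_gt0.
have -> : N / 4 = r ^+ 2 - r ^+ 4 by rewrite -block_radius_eq; ring.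
by field.
Qed.

(** Indices in distinct triples differ by at least 2, so tridiagonality makes the compression
    diagonal; inside each triple the two sides contribute equal shapes that add up to
    [eta_value]. *)
Lemma ellipse_sub_rank_num_range : rank_num_range k A ((x +i* y)%C + a).
Proof.
have [A_tridiag A_diag A_recip A_mean] := A_data.
have r0 : r%:C%C != 0 :> C by rewrite fmorph_eq0 gt_eqF ?block_radius_gt0.
apply/rank_num_rangeP; exists U; first exact: block_unitary.
have AE : A = centered A a + a%:M by rewrite /centered subrK.
rewrite [in LHS]AE mulmxDr mulmxDl mul_mx_scalar -scalemxAl (unitarymxP block_unitary).
rewrite scalemx1 [in RHS]raddfD /=; congr (_ + _).
set B := centered A a.
have B0 (i j : 'I_n) : (i == j) || (i.+1 < j)%N || (j.+1 < i)%N -> B i j = 0.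
  rewrite !mxE; case: eqP => [-> _|_ /= ij]; first by rewrite A_diag subrr.
  by rewrite A_tridiag // subr0.
have BE (i j : 'I_n) : i != j -> B i j = A i j by move=> /negbTE h; rewrite !mxE h subr0.
apply/matrixP => l l'; rewrite mxE.
rewrite (block_vec_sum (l := l')) => [|j Ej]; last by rewrite [(U^t*) _ _]mxE [(U^T) _ _]mxE Ej conjC0 mulr0.
have UB j : (U *m B) l j = U l (idx l i0) * B (idx l i0) j +
    (U l (idx l i1) * B (idx l i1) j + U l (idx l i2) * B (idx l i2) j).
  by rewrite mxE (block_vec_sum (l := l)) // => i ->; rewrite mul0r.
rewrite !UB; have conjU j : (U^t*) j l' = (U l' j)^* by rewrite [LHS]mxE [(U^T) _ _]mxE.
rewrite !conjU.
have [<-|ll] := eqVneq l l'; last first.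
  have BB (t t' : 'I_3) : B (idx l t) (idx l' t') = 0.
    apply: B0; rewrite block_index_neqE /=; move: ll (ltn_ord t) (ltn_ord t'); rewrite -val_eqE /=; clear; lia.
  by rewrite !BB !mulr0 !addr0 !mul0r !addr0 mxE (negbTE ll).
have [h01 h02 h12] := block_index_neq l; have [bb0 bb2 mean1 mean2] := block_mean l.
have Bd t : B (idx l t) (idx l t) = 0 by rewrite B0 ?eqxx.
have -> : B (idx l i0) (idx l i2) = 0 by rewrite B0 //=; clear; lia.
have -> : B (idx l i2) (idx l i0) = 0 by rewrite B0 //=; clear; lia.
rewrite !Bd !BE // 1?eq_sym // [RHS]mxE eqxx mulr1n !block_vecE rC.
rewrite -eta_value.
have sv0 := side_value bb0 mean1; have sv2 := side_value bb2 mean2.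
set u0 := side _ _ in sv0 *; set u2 := side _ _ in sv2 *.
set b0 := A _ _ in sv0 *; set b0' := A _ _ in sv0 *.
set b2 := A _ _ in sv2 *; set b2' := A _ _ in sv2 *.
transitivity (r%:C%C * ((u0 * b0 + u0^* * b0') + (u2 * b2 + u2^* * b2'))); first by ring.
rewrite sv0 sv2 /S rmorphM rmorphD fmorphV rmorph_nat /=; by field.
Qed.
End Blocks.

(** * Behaviour near the vertex on the real axis *)

Import numFieldNormedType.Exports.
Local Open Scope classical_set_scope.

Section UnimodularBounds.
Variable C : numClosedFieldType.

(** Up to the leading coefficient, |p(u)| is at most 2^d and |p(t)| at least e^d. This quantitative
    form replaces continuity of the roots: a polynomial tiny at [t] but not at [u] must have a root
    off the circle or close to [t]. *)
Lemma unimodular_bounds (p : {poly C}) (d : nat) (t u : C) (e : C) :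
  size p = d.+1 -> (forall r, root p r -> `|r| = 1) ->
  0 <= e -> (forall r, root p r -> e <= `|t - r|) -> `|u| <= 1 ->
  `|p.[u]| * e ^+ d <= `|p.[t]| * 2 ^+ d.
Proof.
move=> sp p1 e0 pe u1; have p0 : p != 0 by rewrite -size_poly_eq0 sp.
have [rs pE] := closed_field_poly_normal p.
have rsp r : r \in rs -> root p r.
  by move=> rrs; rewrite pE rootZ ?lead_coef_eq0 // root_prod_XsubC.
have <- : size rs = d.
  by have := sp; rewrite {1}pE size_scale ?lead_coef_eq0 // size_prod_XsubC => -[].
rewrite {1 2}pE !hornerZ !normrM -!mulrA ler_wpM2l // !horner_prod !normr_prod.
have up : \prod_(r <- rs) `|('X - r%:P).[u]| <= 2 ^+ size rs.
  elim: rs rsp {pE} => [|r rs IH] rsp; first by rewrite big_nil.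
  rewrite big_cons exprS ler_pM ?prodr_ge0 ?normr_ge0 //; last first.
    by apply: IH => s ss; apply: rsp; rewrite inE ss orbT.
  rewrite hornerXsubC (le_trans (ler_normB _ _)) // (p1 r) ?rsp ?mem_head //.
  by rewrite -[2]/(1 + 1) lerD2r.
have down : e ^+ size rs <= \prod_(r <- rs) `|('X - r%:P).[t]|.
  elim: rs rsp {pE up} => [|r rs IH] rsp; first by rewrite big_nil.
  rewrite big_cons exprS ler_pM ?exprn_ge0 //.
    by rewrite hornerXsubC pe // rsp ?mem_head.
  by apply: IH => s ss; apply: rsp; rewrite inE ss orbT.
rewrite [leRHS]mulrC; apply: ler_pM => //; first by rewrite prodr_ge0.
by rewrite exprn_ge0.
Qed.

End UnimodularBounds.

Section RealLimits.
Variables (T : Type) (F : set_system T) (FF : ProperFilter F) (R : realType).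
Implicit Types (f g : T -> R) (a b : R).

Lemma fun_cvgD f g a b : f z @[z --> F] --> a -> g z @[z --> F] --> b ->
  f z + g z @[z --> F] --> a + b.
Proof. exact: cvgD. Qed.

Lemma fun_cvgM f g a b : f z @[z --> F] --> a -> g z @[z --> F] --> b ->
  f z * g z @[z --> F] --> a * b.
Proof. exact: cvgM. Qed.

Lemma fun_cvgN f a : f z @[z --> F] --> a -> - f z @[z --> F] --> - a.
Proof. exact: cvgN. Qed.

Lemma fun_cvgX f a k : f z @[z --> F] --> a -> f z ^+ k @[z --> F] --> a ^+ k.
Proof.
move=> fa; elim: k => [|k IH]; first exact: cvg_cst.
by rewrite exprS; under eq_fun do rewrite exprS; exact: fun_cvgM.
Qed.

Lemma fun_cvgV f a : a != 0 -> f z @[z --> F] --> a -> (f z)^-1 @[z --> F] --> a^-1.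
Proof. by move=> a0 fa; exact: cvgV. Qed.

Lemma fun_cvg_sqrt f a :
  f z @[z --> F] --> a -> Num.sqrt (f z) @[z --> F] --> Num.sqrt a.
Proof. by move=> fa; apply: continuous_cvg => //; exact: sqrt_continuous. Qed.

End RealLimits.

(* Matching on the head symbol avoids the very slow failing unifications of a blind search. *)
Ltac cvg_arith := lazymatch goal with
  | |- context [fmap (fun _ => ?c)] => exact: cvg_cst
  | |- context [fmap (fun z => @?f z + @?g z)] => apply: fun_cvgD; cvg_arith
  | |- context [fmap (fun z => @?f z * @?g z)] => apply: fun_cvgM; cvg_arith
  | |- context [fmap (fun z => @?f z ^+ _)] => apply: fun_cvgX; cvg_arith
  | |- context [fmap (fun z => - (@?f z))] => apply: fun_cvgN; cvg_arith
  | |- context [fmap (fun z => (@?f z)^-1)] => apply: fun_cvgV; [ | cvg_arith]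
  | |- context [fmap (fun z => Num.sqrt (@?f z))] => apply: fun_cvg_sqrt; cvg_arith
  | |- context [fmap (fun z => z.1)] => exact: cvg_fst
  | |- context [fmap (fun z => z.2)] => exact: cvg_snd
  | |- context [fmap (fun z => z)] => exact: cvg_at_right_filter
  | |- _ => first [eassumption | exact: cvg_cst]
  end.

Section NearVertex.
Variable R : realType.
Local Notation C := R[i].
Variables (A1 A2 : R).
Hypothesis A1_ge1 : 1 <= A1.
Hypothesis A2_ge1 : 1 <= A2.
Hypothesis A12 : A1 != A2.

Let S := (A1 + A2) / 2.
Variable rho : R.

(** The second assumption puts rho^2 strictly between the two levels of [kap] at c = 1. At z = rho
    the quartic is then real, positive at -1 and negative at 1, so it has a root [t] in between. For
    nearby z its value at [t] stays small and its value at 1 does not, so its roots cannot all be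
    unimodular. *)
Lemma nonunimodular_root_near (kap : R) :
  kap ^+ 2 < 1 ->
  (rho ^+ 2 - (S + 1)) ^+ 2 < kap ^+ 2 * ((A1 + 1) * (A2 + 1)) ->
  \forall z \near (rho, 0 : R), z.1 * z.2 != 0 ->
    exists2 r, root (quartic A1 A2 kap (z.1 +i* z.2)%C) r & `|r| != 1.
Proof.
move=> kap1 rho1.
pose X (B t : R) := t ^+ 2 + 1 + 2 * t * B.
pose al (t x y : R) := ((1 + t) * x) ^+ 2 - ((1 - t) * y) ^+ 2 - X A1 t - X A2 t.
pose be (t x y : R) := - (2 * (1 - t ^+ 2) * (x * y)).
pose re (t x y : R) := al t x y ^+ 2 - be t x y ^+ 2 - 4 * kap ^+ 2 * (X A1 t * X A2 t).
pose im (t x y : R) := 2 * al t x y * be t x y.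
have QE t x y : (quartic A1 A2 kap (x +i* y)%C).[t%:C%C] = (re t x y +i* im t x y)%C.
  rewrite horner_quartic; apply/eqP; rewrite eq_complex /=.
  by apply/andP; split; apply/eqP; rewrite /re /im /al /be /X; ring.
pose Xp (B : R) : {poly R} := 'X ^+ 2 + 1 + 'X * (2 * B)%:P.
pose pr : {poly R} := (((1 + 'X) * rho%:P) ^+ 2 - Xp A1 - Xp A2) ^+ 2
  - (4 * kap ^+ 2)%:P * (Xp A1 * Xp A2).
have prE t : pr.[t] = re t rho 0.
  by rewrite /pr /Xp !hornerE /= /re /al /be /X; ring.
have S1 : 0 < A1 + A2 - 2.
  have := A1_ge1; have := A2_ge1; have /eqP := A12; lra.
have prN1 : 0 < pr.[-1].
  have -> : pr.[-1] = 4 * (A1 - A2) ^+ 2 + 16 * ((1 - kap ^+ 2) * ((A1 - 1) * (A2 - 1))).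
    by rewrite prE /re /al /be /X; ring.
  apply: ltr_pwDl.
    by rewrite mulr_gt0 // exprn_even_gt0 //= subr_eq0.
  by rewrite !mulr_ge0 // subr_ge0 // ltW.
have pr1 : pr.[1] < 0.
  have -> : pr.[1] = 16 * ((rho ^+ 2 - (S + 1)) ^+ 2 - kap ^+ 2 * ((A1 + 1) * (A2 + 1))).
    by rewrite prE /re /al /be /X /S; field.
  by rewrite pmulr_rlt0 // subr_lt0.
have [t /andP[tN1 t1] troot] : exists2 t, -1 <= t <= 1 & root (- pr) t.
  by apply: poly_ivt; rewrite ?hornerN ?oppr_le0 ?oppr_ge0; [lra|rewrite (ltW prN1) (ltW pr1)].
have rt : re t rho 0 = 0 by move: troot; rewrite /root hornerN oppr_eq0 prE => /eqP.
have nt : `|t| < 1.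
  rewrite ltr_norml !lt_neqAle tN1 t1 !andbT; apply/andP; split.
    by apply: contraTneq prN1 => ->; rewrite prE rt ltxx.
  by apply: contraTneq pr1 => <-; rewrite prE rt ltxx.
(* Positivity of [f] is an open condition that denies the square of the inequality in
   [unimodular_bounds] for the points [t] and 1; 256 is the square of 2^4. *)
pose f (x y : R) := (re 1 x y) ^+ 2 * (1 - `|t|) ^+ 8 - 256 * (re t x y ^+ 2 + im t x y ^+ 2).
have f0 : 0 < f rho 0.
  have -> : f rho 0 = re 1 rho 0 ^+ 2 * (1 - `|t|) ^+ 8.
    by rewrite /f rt /im /be !mulr0 oppr0 mulr0; ring.
  apply: mulr_gt0; last by rewrite exprn_gt0 // subr_gt0.
  by rewrite -prE exprn_even_gt0 //= lt_eqF.
have fc : f z.1 z.2 @[z --> (rho, 0 : R)] --> f rho 0.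
  by rewrite /f /im /re /be /al /X; cvg_arith.
near=> z.
have fz : 0 < f z.1 z.2 by near: z; apply: (cvgr_gt _ fc).
move: fz; case: {+}z => x y /= fz xy0.
have [sQ _] := size_quartic A1 A2 (nonreal_sqr_neq kap xy0).
apply: contrapT => none.
have unimod r : root (quartic A1 A2 kap (x +i* y)%C) r -> `|r| = 1.
  by move=> Qr; apply/eqP/negPn/negP => r1; apply: none; exists r.
have := @unimodular_bounds _ _ 4 t%:C%C (1%:C)%C (1 - `|t|)%:C%C sQ unimod.
have nC (r : R) : `|r%:C%C| = `|r|%:C%C :> C.
  by rewrite normc_def /= expr0n /= addr0 sqrtr_sqr.
have e1 r : root (quartic A1 A2 kap (x +i* y)%C) r -> (1 - `|t|)%:C%C <= `|t%:C%C - r|.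
  move=> /unimod r1; rewrite distrC (le_trans _ (lerB_dist _ _)) // r1 nC.
  by rewrite rmorphB.
rewrite lecR subr_ge0 (ltW nt) => /(_ isT e1); rewrite nC normr1 lexx => /(_ isT).
rewrite !QE !normc_def /= -rmorphXn -(rmorph_nat (real_complex R) 2) -rmorphXn -!rmorphM lecR.
have -> : im 1 x y = 0 by rewrite /im /be expr1n subrr mulr0 mul0r oppr0 mulr0.
rewrite expr0n addr0 sqrtr_sqr; have e0 : 0 <= 1 - `|t| by rewrite subr_ge0 ltW.
move: fz e0; rewrite /f.
move: (re 1 x y) (re t x y) (im t x y) (1 - `|t|) => u v w e fz e0 H.
suff : u ^+ 2 * e ^+ 8 <= 256 * (v ^+ 2 + w ^+ 2) by lra.
have := H; rewrite -(@ler_pXn2r _ 2) ?nnegrE ?mulr_ge0 ?sqrtr_ge0 ?exprn_ge0 //.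
rewrite ![(_ * _ ^+ 4) ^+ 2]exprMn sqr_sqrtr ?addr_ge0 ?sqr_ge0 // real_normK ?num_real //.
have -> : (e ^+ 4) ^+ 2 = e ^+ 8 by ring.
have -> : (2 ^+ 4) ^+ 2 = 256 :> R by ring.
by move=> ?; lra.
Unshelve. all: by end_near.
Qed.

(** Now rho^2 is on the upper level itself and the limiting quartic vanishes at 1. The strict bound
    leaves to unimodular roots only the lower level, and this keeps them away from 1. The value at 1
    is small, the one at -1 is not, and [unimodular_bounds] applies again. *)
Lemma nonunimodular_root_near_tangent (kap : R) :
  0 < kap < 1 ->
  rho ^+ 2 = S + 1 + kap * Num.sqrt ((A1 + 1) * (A2 + 1)) ->
  \forall z \near (rho, 0 : R), z.1 * z.2 != 0 ->
    (forall p q, p ^+ 2 + q ^+ 2 = 1 -> (p * z.1 - q * z.2) ^+ 2 <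
       S + (p ^+ 2 - q ^+ 2) +
       kap * Num.sqrt ((A1 + (p ^+ 2 - q ^+ 2)) * (A2 + (p ^+ 2 - q ^+ 2)))) ->
    exists2 r, root (quartic A1 A2 kap (z.1 +i* z.2)%C) r & `|r| != 1.
Proof.
have A1g := A1_ge1; have A2g := A2_ge1.
move=> /andP[kap0 kap1]; set w1 := Num.sqrt _ => rho2.
have w12 : w1 ^+ 2 = (A1 + 1) * (A2 + 1) by rewrite sqr_sqrtr // mulr_ge0 //; lra.
have w10 : 0 < w1 by rewrite sqrtr_gt0 mulr_gt0 //; lra.
have SE : A1 + A2 = 2 * S by rewrite /S; field.
have A12S : 0 < (S - 1) ^+ 2 - (A1 - 1) * (A2 - 1).
  have -> : (S - 1) ^+ 2 - (A1 - 1) * (A2 - 1) = (A1 - A2) ^+ 2 / 4 by rewrite /S; field.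
  by rewrite divr_gt0 // exprn_even_gt0 //= subr_eq0.
have kw0 : 0 < kap * w1 by rewrite mulr_gt0.
have rho2_gt0 : 0 < rho ^+ 2 by rewrite rho2; lra.
(* A unimodular root (p + i q)^2 lies at distance 2 |q| from 1; if 4 q^2 < D, being on the lower
   level would contradict 0 < g. *)
pose D := kap * w1 / rho ^+ 2.
have D0 : 0 < D by rewrite divr_gt0.
pose g (x y : R) := x ^+ 2 - (S + 1) - D * x ^+ 2 / 2 - y ^+ 2.
pose a1 (x y : R) := (x ^+ 2 - (S + 1)) ^+ 2 - kap ^+ 2 * ((A1 + 1) * (A2 + 1)).
pose b1 (x y : R) := (y ^+ 2 - (S - 1)) ^+ 2 - kap ^+ 2 * ((A1 - 1) * (A2 - 1)).
pose f (x y : R) := D ^+ 4 * b1 x y ^+ 2 - 256 * a1 x y ^+ 2.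
have g0 : 0 < g rho 0.
  have -> : g rho 0 = kap * w1 / 2; last by rewrite divr_gt0.
  rewrite /g /D divfK ?gt_eqF // rho2 expr0n /=; by field.
have b0 : 0 < b1 rho 0.
  rewrite /b1 expr0n /= sub0r sqrrN.
  have AB : 0 <= (A1 - 1) * (A2 - 1) by rewrite mulr_ge0 // subr_ge0.
  have : kap ^+ 2 < 1 by rewrite exprn_ilt1 // ltW.
  nra.
have f0 : 0 < f rho 0.
  have -> : f rho 0 = D ^+ 4 * b1 rho 0 ^+ 2; last by rewrite mulr_gt0 ?exprn_gt0.
  rewrite /f; have -> : a1 rho 0 = 0 by rewrite /a1 rho2 -w12; ring.
  by ring.
have gc : g z.1 z.2 @[z --> (rho, 0 : R)] --> g rho 0 by rewrite /g; cvg_arith.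
have fc : f z.1 z.2 @[z --> (rho, 0 : R)] --> f rho 0 by rewrite /f /a1 /b1; cvg_arith.
near=> z.
have gz : 0 < g z.1 z.2 by near: z; apply: (cvgr_gt _ gc).
have fz : 0 < f z.1 z.2 by near: z; apply: (cvgr_gt _ fc).
move: gz fz; case: {+}z => x y /= gz fz xy0 below.
have [sQ _] := size_quartic A1 A2 (nonreal_sqr_neq kap xy0).
apply: contrapT => none.
have unimod r : root (quartic A1 A2 kap (x +i* y)%C) r -> `|r| = 1.
  by move=> Qr; apply/eqP/negPn/negP => r1; apply: none; exists r.
have far r : root (quartic A1 A2 kap (x +i* y)%C) r -> (Num.sqrt D)%:C%C <= `|1 - r|.
  move=> Qr; have := unimod r Qr => /unit_complex_sqr[p [q [pq1 rE]]].
  move: Qr; rewrite /root rE horner_quartic_unit //= mulf_eq0 => /orP[].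
    rewrite mulf_eq0 pnatr_eq0 /= expf_eq0 /= => /eqP E.
    by have := pq1; case: E => -> ->; rewrite expr0n /= addr0 => /eqP; rewrite eq_sym oner_eq0.
  have := below p q pq1; have c1 : -1 <= p ^+ 2 - q ^+ 2 by nra.
  rewrite -/S; set c := p ^+ 2 - q ^+ 2 in c1 *; set w := Num.sqrt _.
  have w2 : w ^+ 2 = (A1 + c) * (A2 + c) by rewrite sqr_sqrtr // mulr_ge0 //; lra.
  have w0 : 0 <= w by exact: sqrtr_ge0.
  rewrite -w2 => blw /eqP/(congr1 (@complex.Re R)) /= E.
  have E' : ((p * x - q * y) ^+ 2 - (S + c) - kap * w) *
            ((p * x - q * y) ^+ 2 - (S + c) + kap * w) = 0.
    by rewrite -subr_sqr exprMn.
  have up : (p * x - q * y) ^+ 2 <= S + c.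
    move/eqP: E'; rewrite mulf_eq0 => /orP[] /eqP E1; first by lra.
    by have : 0 <= kap * w by [rewrite mulr_ge0 // ltW]; lra.
  rewrite normc_def lecR ler_sqrt ?addr_ge0 ?sqr_ge0 //=.
  have -> : (1 - (p * p - q * q)) ^+ 2 + (0 - (p * q + q * p)) ^+ 2 = 4 * q ^+ 2.
    by transitivity ((1 - (p ^+ 2 + q ^+ 2)) ^+ 2 + 4 * q ^+ 2); [ring | rewrite pq1; ring].
  rewrite leNgt; apply/negP => qD; move: gz; rewrite /g => gz.
  have qx : q ^+ 2 * x ^+ 2 <= D / 4 * x ^+ 2 by rewrite ler_wpM2r ?sqr_ge0 // ler_pdivlMr // mulrC ltW.
  have pqx : p ^+ 2 * (q ^+ 2 * x ^+ 2) <= q ^+ 2 * x ^+ 2.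
    by apply: ler_piMl; [rewrite mulr_ge0 ?sqr_ge0 | rewrite -pq1 lerDl sqr_ge0].
  have pqxy := sqr_ge0 (p * q * x - y); have qy : 0 <= q ^+ 2 * y ^+ 2 by rewrite mulr_ge0 ?sqr_ge0.
  have q0 := sqr_ge0 q.
  have pE : p ^+ 2 = 1 - q ^+ 2 by rewrite -pq1; ring.
  have E1 : (p * x - q * y) ^+ 2 = x ^+ 2 - q ^+ 2 * x ^+ 2 - 2 * p * q * x * y + q ^+ 2 * y ^+ 2.
    transitivity (p ^+ 2 * x ^+ 2 - 2 * p * q * x * y + q ^+ 2 * y ^+ 2); first by ring.
    by rewrite pE; ring.
  have E2 : (p * q * x - y) ^+ 2 = p ^+ 2 * (q ^+ 2 * x ^+ 2) - 2 * p * q * x * y + y ^+ 2 by ring.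
  rewrite /c pE E1 in up; rewrite E2 in pqxy; lra.
have := @unimodular_bounds _ _ 4 1 (-1) (Num.sqrt D)%:C%C sQ unimod.
rewrite ler0c sqrtr_ge0 normrN1 lexx => /(_ isT far isT).
have Q1 : (quartic A1 A2 kap (x +i* y)%C).[1] = (16 * a1 x y)%:C%C.
  rewrite horner_quartic; apply/eqP; rewrite eq_complex /=.
  by apply/andP; split; apply/eqP; rewrite /a1 /S; field.
have QN1 : (quartic A1 A2 kap (x +i* y)%C).[-1] = (16 * b1 x y)%:C%C.
  rewrite horner_quartic; apply/eqP; rewrite eq_complex /=.
  by apply/andP; split; apply/eqP; rewrite /b1 /S; field.
have nC (r : R) : `|r%:C%C| = `|r|%:C%C :> C.
  by rewrite normc_def /= expr0n /= addr0 sqrtr_sqr.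
rewrite Q1 QN1 !nC -rmorphXn -(rmorph_nat (real_complex R) 2) -rmorphXn -!rmorphM lecR => H.
move: fz H; rewrite /f; move: (a1 x y) (b1 x y) => u v fz.
rewrite -(@ler_pXn2r _ 2) ?nnegrE ?mulr_ge0 ?sqrtr_ge0 ?exprn_ge0 //.
have s8 : (Num.sqrt D ^+ 4) ^+ 2 = D ^+ 4.
  by rewrite -[in RHS](@sqr_sqrtr _ D) ?(ltW D0) //; ring.
rewrite ![(_ * _ ^+ 4) ^+ 2]exprMn s8 !real_normK ?num_real //.
have -> : (2 ^+ 4) ^+ 2 = 256 :> R by ring.
by move=> ?; lra.
Unshelve. all: by end_near.
Qed.
End NearVertex.

(** * Concavity of the geometric mean *)

Section GeometricMean.
Variables (R : realType) (A1 A2 : R).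
Hypothesis A1_ge1 : 1 <= A1.
Hypothesis A2_ge1 : 1 <= A2.

Definition gmean (c : R) := Num.sqrt ((A1 + c) * (A2 + c)).
(** Symmetric, affine in each argument and equal to (A1 + c) (A2 + c) on the diagonal: for c > -1, b
    |-> polar b c / gmean c is the tangent line of [gmean] at c. *)
Definition polar (b c : R) := ((A1 + b) * (A2 + c) + (A2 + b) * (A1 + c)) / 2.

Lemma gmean_sqr (c : R) : -1 <= c -> gmean c ^+ 2 = (A1 + c) * (A2 + c).
Proof.
have A1g := A1_ge1; have A2g := A2_ge1.
by move=> c1; rewrite sqr_sqrtr // mulr_ge0 //; lra.
Qed.

Lemma gmean_ge0 (c : R) : 0 <= gmean c. Proof. exact: sqrtr_ge0. Qed.

Lemma gmean_gt0 (c : R) : -1 < c -> 0 < gmean c.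
Proof.
have A1g := A1_ge1; have A2g := A2_ge1.
by move=> c1; rewrite sqrtr_gt0 mulr_gt0 //; lra.
Qed.

Lemma gmean_le (c : R) : -1 <= c -> gmean c <= (A1 + A2) / 2 + c.
Proof.
have A1g := A1_ge1; have A2g := A2_ge1.
move=> c1; rewrite -(@ler_pXn2r _ 2) ?nnegrE ?gmean_ge0 //; last by lra.
by rewrite gmean_sqr //; have := sqr_ge0 (A1 - A2); nra.
Qed.

Lemma polar_ge0 (b c : R) : -1 <= b -> -1 <= c -> 0 <= polar b c.
Proof.
have A1g := A1_ge1; have A2g := A2_ge1.
by move=> b1 c1; rewrite divr_ge0 // addr_ge0 // mulr_ge0 //; lra.
Qed.

(** A reversed Cauchy-Schwarz inequality as an identity; its right side shows where concavity is
    strict. *)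
Lemma polar_sqr_sub (b c : R) : polar b c ^+ 2 - ((A1 + b) * (A2 + b)) * ((A1 + c) * (A2 + c)) =
  ((A1 - A2) * (b - c) / 2) ^+ 2.
Proof. by rewrite /polar; field. Qed.

Lemma gmean_polar_le (b c : R) : -1 <= b -> -1 <= c -> gmean b * gmean c <= polar b c.
Proof.
move=> b1 c1; rewrite -(@ler_pXn2r _ 2) ?nnegrE ?polar_ge0 ?mulr_ge0 ?gmean_ge0 //.
by rewrite exprMn !gmean_sqr // -subr_ge0 polar_sqr_sub sqr_ge0.
Qed.

Lemma gmean_polar_lt (b c : R) : A1 != A2 -> b != c -> -1 <= b -> -1 <= c ->
  gmean b * gmean c < polar b c.
Proof.
move=> A12 bc b1 c1; rewrite -(@ltr_pXn2r _ 2) ?nnegrE ?polar_ge0 ?mulr_ge0 ?gmean_ge0 //.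
rewrite exprMn !gmean_sqr // -subr_gt0 polar_sqr_sub exprn_even_gt0 //=.
by rewrite !mulf_eq0 invr_eq0 !subr_eq0 (negbTE A12) (negbTE bc) pnatr_eq0.
Qed.

Lemma gmean_concave (a b s : R) : -1 <= a -> -1 <= b -> 0 <= s <= 1 ->
  -1 < (1 - s) * a + s * b ->
  (1 - s) * gmean a + s * gmean b <= gmean ((1 - s) * a + s * b).
Proof.
move=> a1 b1 /andP[s0 s1]; set c := (1 - s) * a + s * b => c1.
rewrite -(ler_pM2r (gmean_gt0 c1)) -expr2 gmean_sqr; last exact: ltW.
have Ha : (1 - s) * (gmean a * gmean c) <= (1 - s) * polar a c.
  by rewrite ler_wpM2l ?subr_ge0 // gmean_polar_le // ltW.
have Hb : s * (gmean b * gmean c) <= s * polar b c.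
  by rewrite ler_wpM2l // gmean_polar_le // ltW.
have E : (1 - s) * polar a c + s * polar b c = (A1 + c) * (A2 + c).
  by rewrite /polar /c; field.
by rewrite -E mulrDl -(mulrA (1 - s)) -(mulrA s); apply: lerD.
Qed.

Lemma gmean_midpoint (a b : R) : A1 != A2 -> a != b -> -1 <= a -> -1 <= b ->
  (gmean a + gmean b) / 2 < gmean ((a + b) / 2).
Proof.
move=> A12 ab a1 b1; set c := (a + b) / 2.
have c1 : -1 < c.
  rewrite /c; move: ab; rewrite neq_lt => /orP[] ?; lra.
have ca : a != c by apply: contraNneq ab => ac; apply/eqP; rewrite /c in ac; lra.
have cb : b != c by apply: contraNneq ab => bc; apply/eqP; rewrite /c in bc; lra.
rewrite -(ltr_pM2r (gmean_gt0 c1)) -expr2 gmean_sqr; last exact: ltW.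
have Ha := gmean_polar_lt A12 ca a1 (ltW c1).
have Hb := gmean_polar_lt A12 cb b1 (ltW c1).
have E : (polar a c + polar b c) / 2 = (A1 + c) * (A2 + c) by rewrite /polar /c; field.
rewrite -E; lra.
Qed.

End GeometricMean.

Section Symmetry.
Variables (R : realType) (m : nat).
Local Notation C := R[i].
Local Notation n := m.*2.+1.
Variables (A : 'M[C]_n) (a : C) (A1 A2 : R).
Hypothesis A_data : recip_data A a A1 A2.

(** Conjugation by the diagonal matrix of alternating signs flips the off-diagonal entries and so
    turns [A] into 2 a - A. *)
Lemma rank_num_range_sym k z : rank_num_range k A z -> rank_num_range k A (2 * a - z).
Proof.
have [A_tridiag A_diag _ _] := A_data.
move=> /rank_num_rangeP[U Uu UA].
pose E : 'M[C]_n := diag_mx (\row_i (-1) ^+ i).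
have Eh : E^t* = E.
  apply/matrixP=> i j; rewrite !mxE; have [->|ji] := eqVneq j i.
    by rewrite !mulr1n rmorphXn rmorphN rmorph1.
  by rewrite !mulr0n conjC0.
have EE : E *m E = 1%:M.
  apply/matrixP=> i j; rewrite mul_diag_mx !mxE mulrnAr -expr2 sqrr_sign.
  by case: eqP => // ->.
have EAE : E *m A *m E = (2 * a)%:M - A.
  apply/matrixP=> i j; rewrite mul_mx_diag mul_diag_mx !mxE.
  have [->|ij] := eqVneq i j; first by rewrite mulr1n A_diag mulrAC -expr2 sqrr_sign; ring.
  rewrite mulr0n sub0r; have [hj|hj] := boolP ((i.+1 < j)%N || (j.+1 < i)%N).
    by rewrite A_tridiag // mulr0 mul0r oppr0.
  rewrite mulrAC -exprD -signr_odd.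
  have -> : odd (i + j).
    move: ij hj; rewrite -val_eqE /= => ij hj.
    have [->|->] : (j = i.+1 :> nat) \/ (i = j.+1 :> nat) by lia.
      by rewrite addnS addnn /= odd_double.
    by rewrite addSn addnn /= odd_double.
  by rewrite expr1 mulN1r.
apply/rank_num_rangeP; exists (U *m E).
  apply/unitarymxP; rewrite trmx_mul map_mxM Eh mulmxA -(mulmxA U) EE mulmx1.
  exact/unitarymxP.
rewrite trmx_mul map_mxM Eh !mulmxA -(mulmxA U E A) -(mulmxA U _ E) EAE.
rewrite mulmxBr mulmxBl UA mul_mx_scalar -scalemxAl (unitarymxP Uu) scalemx1.
by rewrite -raddfB.
Qed.

End Symmetry.

Section NearRange.
Variables (R : realType) (m : nat).
Local Notation C := R[i].
Local Notation n := m.*2.+1.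
Variables (A : 'M[C]_n) (a : C) (A1 A2 : R).
Hypothesis A_data : recip_data A a A1 A2.
Hypothesis A1_ge1 : 1 <= A1.
Hypothesis A2_ge1 : 1 <= A2.
Hypothesis A12 : A1 != A2.
Variable k : nat.
Hypothesis km : (0 < k <= m)%N.

Lemma near_forall_lt (T : Type) (F : set_system T) {FF : Filter F} (P : nat -> T -> Prop) N :
  (forall j, (j < N)%N -> \forall z \near F, P j z) ->
  \forall z \near F, forall j, (j < N)%N -> P j z.
Proof.
elim: N => [|N IH] H; first by near=> z.
have H1 := IH (fun j jN => H j (ltnW jN)); have H2 := H N (ltnSn N).
near=> z => j; rewrite ltnS leq_eqVlt => /orP[/eqP->|jN].
  by near: z.
by move: j jN; near: z.
Unshelve. all: by end_near.
Qed.

(** For j < k < m + 1 - j, kappa_j exceeds |kappa_k|, so rho^2 lies strictly between the levels of j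
    and m + 1 - j at c = 1. For j = k it lies on the upper one, the tangent case. Finitely many j
    allow a common neighbourhood. *)
Lemma rank_num_range_near : exists2 e : R, 0 < e & forall x y : R,
  `|x - Num.sqrt (sq_level m A1 A2 k 1)| < e -> `|y| < e -> x * y != 0 ->
  (forall p q, p ^+ 2 + q ^+ 2 = 1 ->
     (p * x - q * y) ^+ 2 < sq_level m A1 A2 k (p ^+ 2 - q ^+ 2)) ->
  rank_num_range k A ((x +i* y)%C + a).
Proof.
have A1g := A1_ge1; have A2g := A2_ge1; have /andP[k0 km'] := km.
have m1 : -1 <= 1 :> R by lra.
have m1' : -1 < 1 :> R by lra.
set rho := Num.sqrt _.
have rho2 : rho ^+ 2 = (A1 + A2) / 2 + 1 + kappa R m k * gmean A1 A2 1.
  by rewrite sqr_sqrtr ?sq_level_ge0.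
have w0 : 0 < gmean A1 A2 1 by apply: gmean_gt0.
have w2 : gmean A1 A2 1 ^+ 2 = (A1 + 1) * (A2 + 1) by rewrite gmean_sqr.
pose P j (z : R * R) := (0 < j)%N -> (k + j < m.+1)%N -> z.1 * z.2 != 0 ->
  (forall p q, p ^+ 2 + q ^+ 2 = 1 ->
     (p * z.1 - q * z.2) ^+ 2 < sq_level m A1 A2 k (p ^+ 2 - q ^+ 2)) ->
  exists2 r, root (quartic A1 A2 (kappa R m j) (z.1 +i* z.2)%C) r & `|r| != 1.
have HP : \forall z \near (rho, 0 : R), forall j, (j < k.+1)%N -> P j z.
  apply: (@near_forall_lt _ (nbhs (rho, 0 : R)) _ P) => j jk.
  have [j0|j0] := posnP j; first by near=> z; rewrite /P j0.
  have [kj|kj] := leqP m.+1 (k + j); first by near=> z => _; rewrite ltnNge kj.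
  have jm : (0 < j <= m)%N by lia.
  have k1 := kappa_bounds R jm; have kb := kappa_bounds R km.
  move: jk; rewrite ltnS leq_eqVlt => /orP[/eqP jk|jk].
    have kpos : 0 < kappa R m k < 1.
      by case/andP: kb => _ ->; rewrite andbT kappa_gt0 //; lia.
    have := nonunimodular_root_near_tangent A1_ge1 A2_ge1 A12 kpos rho2.
    apply: filterS => z Hz _ _ xy0 below; by rewrite jk; apply: Hz.
  have [jm1 km1 kj1] : [/\ (k <= m.+1)%N, (m.+1 - k <= m.+1)%N & (j < m.+1 - k)%N].
    by split; move: km kj; clear; lia.
  have lt1 : kappa R m k < kappa R m j by exact: kappa_lt.
  have lt2 : - kappa R m k < kappa R m j by rewrite -kappa_rev // kappa_lt.
  have := @nonunimodular_root_near R A1 A2 A1_ge1 A2_ge1 A12 rho (kappa R m j).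
  have ks : kappa R m j ^+ 2 < 1 by case/andP: k1 => ? ?; nra.
  move=> /(_ ks); have -> : rho ^+ 2 - ((A1 + A2) / 2 + 1) = kappa R m k * gmean A1 A2 1.
    by rewrite rho2; ring.
  rewrite -w2 exprMn ltr_pM2r ?exprn_gt0 // => H.
  have : kappa R m k ^+ 2 < kappa R m j ^+ 2 by nra.
  by move=> /H; apply: filterS => z Hz _ _ xy0 _; exact: Hz.
move: HP => /nbhs_ballP[e /= e0 He].
exists e => // x y xe ye xy0 below.
apply: (rank_num_range_below A_data A1_ge1 A2_ge1 km xy0 below) => j /andP[j0 jk] kj.
apply: (He (x, y) _ j) => //.
by split => /=; rewrite /ball /= ?sub0r ?normrN // distrC.
Unshelve. all: by end_near.
Qed.

End NearRange.

(** * The support function of an elliptical rank-k numerical range *)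

Section Center.
Variable R : realType.
Local Notation C := R[i].

Lemma bounded_translation_eq0 (E : set C) (z v f : C) (d : R) :
  E z -> (forall w, E w -> E (w + v)) -> (forall w, E w -> `|w - f| <= d%:C%C) -> v = 0.
Proof.
move=> Ez Ev Ed; apply/eqP/negPn/negP => v0.
have ENz N : E (z + v *+ N).
  by elim: N => [|N IH]; rewrite ?mulr0n ?addr0 // mulrSr addrA; exact: Ev.
pose r := Num.sqrt (complex.Re v ^+ 2 + complex.Im v ^+ 2).
have vr : `|v| = r%:C%C by rewrite normc_def.
have r0 : 0 < r by rewrite -ltcR -vr normr_gt0.
have bd N : N%:R * r <= d + d.
  have vN : `|v *+ N| = (N%:R * r)%:C%C by rewrite normrMn vr -rmorphMn mulr_natl.
  rewrite -lecR -vN rmorphD.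
  have -> : v *+ N = (z + v *+ N - f) - (z - f) by ring.
  by rewrite (le_trans (ler_normB _ _)) // lerD // Ed.
have d0 : 0 <= d + d by have := bd 0%N; rewrite mul0r.
have := archi_boundP (divr_ge0 d0 (ltW r0)); rewrite ltr_pdivrMr // => H.
by have := bd (Num.bound ((d + d) / r)); rewrite leNgt H.
Qed.

End Center.

Section SupportForm.
Variables (R : realType) (b2 u v : R).
Hypothesis b2_gt0 : 0 < b2.

(** The squared support function of the ellipse with foci u + i v and - (u + i v) and squared
    semi-minor axis [b2]. *)
Definition sq_support (p q : R) := b2 + (p * u - q * v) ^+ 2.
(** Averaging over theta and - theta removes the term in sin (2 theta) and leaves an affine function
    of c. *)
Definition mean_support (c : R) := b2 + u ^+ 2 * ((1 + c) / 2) + v ^+ 2 * ((1 - c) / 2).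

Lemma mean_supportE p q : p ^+ 2 + q ^+ 2 = 1 ->
  mean_support (p ^+ 2 - q ^+ 2) = (sq_support p q + sq_support p (- q)) / 2.
Proof.
move=> pq1; rewrite /mean_support /sq_support -[X in (X + _) / 2]pq1 -[X in (X - _) / 2]pq1.
by field.
Qed.

(** After rotation by p + i q, the focus is u' + i v' and the contact point is h + i y'. *)
Lemma sq_support_attained p q : p ^+ 2 + q ^+ 2 = 1 ->
  exists x y, (p * x - q * y) ^+ 2 = sq_support p q /\
    forall P Q, P ^+ 2 + Q ^+ 2 = 1 -> (P * x - Q * y) ^+ 2 <= sq_support P Q.
Proof.
move=> pq1; have b0 := b2_gt0.
pose u' := p * u - q * v; pose v' := p * v + q * u.
pose h := Num.sqrt (b2 + u' ^+ 2).
have h2 : h ^+ 2 = b2 + u' ^+ 2 by rewrite sqr_sqrtr // addr_ge0 ?sqr_ge0 // ltW.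
have h0 : 0 < h by rewrite sqrtr_gt0 ltr_pwDl // sqr_ge0.
have hn0 : h != 0 by rewrite gt_eqF.
pose y' := u' * v' / h.
exists (p * h + q * y'), (p * y' - q * h); split.
  have -> : p * (p * h + q * y') - q * (p * y' - q * h) = (p ^+ 2 + q ^+ 2) * h by ring.
  by rewrite pq1 mul1r h2.
move=> P Q PQ1; pose c := P * p + Q * q; pose s := Q * p - P * q.
have cs1 : c ^+ 2 + s ^+ 2 = 1.
  by transitivity ((P ^+ 2 + Q ^+ 2) * (p ^+ 2 + q ^+ 2)); [rewrite /c /s; ring | rewrite PQ1 pq1 mul1r].
have -> : P * (p * h + q * y') - Q * (p * y' - q * h) = c * h - s * y'.
  by rewrite /c /s; ring.
have uE : c * u' - s * v' = P * u - Q * v.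
  transitivity ((p ^+ 2 + q ^+ 2) * (P * u - Q * v)); last by rewrite pq1 mul1r.
  by rewrite /c /s /u' /v'; ring.
rewrite /sq_support -uE -subr_ge0.
have -> : b2 + (c * u' - s * v') ^+ 2 - (c * h - s * y') ^+ 2 =
   s ^+ 2 * (b2 + v' ^+ 2 * b2 / h ^+ 2).
  have hu : u' ^+ 2 = h ^+ 2 - b2 by rewrite h2; ring.
  transitivity (b2 + c ^+ 2 * u' ^+ 2 + s ^+ 2 * v' ^+ 2 - c ^+ 2 * h ^+ 2
     - s ^+ 2 * (u' ^+ 2 * v' ^+ 2 / h ^+ 2)).
    by rewrite /y'; field.
  rewrite hu.
  transitivity ((1 - c ^+ 2) * b2 + s ^+ 2 * (v' ^+ 2 * b2 / h ^+ 2)); first by field.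
  by rewrite -cs1; ring.
apply: mulr_ge0; first exact: sqr_ge0.
apply: addr_ge0; first exact: ltW.
by apply: divr_ge0; [apply: mulr_ge0; [exact: sqr_ge0 | exact: ltW] | exact: sqr_ge0].
Qed.

End SupportForm.

Section NotElliptical.
Variables (R : realType) (m : nat).
Local Notation C := R[i].
Local Notation n := m.*2.+1.
Variables (A : 'M[C]_n) (a : C) (A1 A2 : R).
Hypothesis A_data : recip_data A a A1 A2.
Hypothesis A1_ge1 : 1 <= A1.
Hypothesis A2_ge1 : 1 <= A2.
Hypothesis A12 : A1 != A2.
Variable k : nat.
Hypothesis km : (0 < k <= m)%N.

Lemma elliptical_support : elliptical_disk (rank_num_range k A) ->
  exists b2 u v : R, 0 < b2 /\ forall x y, rank_num_range k A ((x +i* y)%C + a) <->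
    forall p q, p ^+ 2 + q ^+ 2 = 1 -> (p * x - q * y) ^+ 2 <= sq_support b2 u v p q.
Proof.
move=> [f1 [f2 [d [fd EE]]]].
have d0 : 0 < d.
  have : 0 < d%:C%C :> C by apply: le_lt_trans fd.
  by rewrite ltcE /= => /andP[].
have Ez z : rank_num_range k A z <-> `|z - f1| + `|z - f2| <= d%:C%C by rewrite EE.
(* The range is symmetric about a and about the midpoint of the foci; the composite of the two
   reflections is a translation of a bounded nonempty set, hence trivial. *)
have cen : f1 + f2 - 2 * a = 0.
  apply: (@bounded_translation_eq0 _ (rank_num_range k A) f1 _ f1 d).
  - by apply/Ez; rewrite subrr normr0 add0r ltW.
  - move=> w /(rank_num_range_sym A_data) /Ez H; apply/Ez.
    rewrite distrC [X in _ + X]distrC addrC.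
    have -> : f2 - (w + (f1 + f2 - 2 * a)) = 2 * a - w - f1 by ring.
    by have -> : f1 - (w + (f1 + f2 - 2 * a)) = 2 * a - w - f2 by ring.
  - by move=> w /Ez; apply: le_trans; rewrite lerDl.
case fE : ((f1 - f2) / 2) => [u v].
have f1E : f1 = a + (u +i* v)%C.
  rewrite -fE; have -> : a = (f1 + f2) / 2 by rewrite -(subrK (2 * a) (f1 + f2)) cen add0r; field.
  by field.
have f2E : f2 = a - (u +i* v)%C.
  rewrite -fE; have -> : a = (f1 + f2) / 2 by rewrite -(subrK (2 * a) (f1 + f2)) cen add0r; field.
  by field.
exists (d ^+ 2 / 4 - (u ^+ 2 + v ^+ 2)), u, v; split.
  have : `|f1 - f2| = (2 * Num.sqrt (u ^+ 2 + v ^+ 2))%:C%C.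
    have -> : f1 - f2 = 2 * (u +i* v)%C by rewrite f1E f2E; ring.
    by rewrite normrM normr_nat normc_def rmorphM rmorph_nat.
  move=> E; move: fd; rewrite E ltcR => H.
  have s0 : 0 <= Num.sqrt (u ^+ 2 + v ^+ 2) by exact: sqrtr_ge0.
  have s2 : Num.sqrt (u ^+ 2 + v ^+ 2) ^+ 2 = u ^+ 2 + v ^+ 2.
    by rewrite sqr_sqrtr // addr_ge0 ?sqr_ge0.
  by rewrite -s2; nra.
move=> x y; rewrite Ez f1E f2E.
have -> : (x +i* y)%C + a - (a + (u +i* v)%C) = (x +i* y)%C - (u +i* v)%C by ring.
have -> : (x +i* y)%C + a - (a - (u +i* v)%C) = (x +i* y)%C + (u +i* v)%C by ring.
exact: ellipse_supportP (ltW d0).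
Qed.

Let F c := sq_level m A1 A2 k c.

Lemma sq_level_gt0 c : -1 <= c -> 0 < F c.
Proof.
move=> c1; have := kappa_bounds R km; rewrite /F /sq_level -/(gmean A1 A2 c).
have := gmean_le A1_ge1 A2_ge1 c1; have := gmean_ge0 A1 A2 c.
have : 0 < (A1 + A2) / 2 + c.
  have A1g := A1_ge1; have A2g := A2_ge1.
  by move: A12; rewrite neq_lt => /orP[] ?; lra.
move: (gmean _ _ _) (_ / 2 + _) (kappa _ _ _) => w s kap s0 w0 ws /andP[k1 k2].
have [kn|kp] := leP 0 kap; [nra|].
have : kap * w >= kap * s by rewrite ler_wnM2l // ltW.
nra.
Qed.

End NotElliptical.

Lemma pos_lower_bound3 (R : realDomainType) (a b c : R) : 0 < a -> 0 < b -> 0 < c ->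
  exists t, [/\ 0 < t, t <= a, t <= b & t <= c].
Proof.
move=> a0 b0 c0; exists (Num.min a (Num.min b c)).
by split; rewrite ?lt_min ?a0 ?b0 // !ge_min lexx ?orbT.
Qed.

(** * An elliptical range against the curvature of the bound *)

Section EllipseContradiction.
Variables (R : realType) (m : nat).
Local Notation C := R[i].
Local Notation n := m.*2.+1.
Variables (A : 'M[C]_n) (a : C) (A1 A2 : R).
Hypothesis A_data : recip_data A a A1 A2.
Hypothesis A1_ge1 : 1 <= A1.
Hypothesis A2_ge1 : 1 <= A2.
Hypothesis A12 : A1 != A2.
Variable k : nat.
Hypothesis km : (0 < k <= m)%N.
Variables b2 u v : R.
Hypothesis b2_gt0 : 0 < b2.
Hypothesis range_support : forall x y, rank_num_range k A ((x +i* y)%C + a) <->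
  forall p q, p ^+ 2 + q ^+ 2 = 1 -> (p * x - q * y) ^+ 2 <= sq_support b2 u v p q.

Let F (c : R) := sq_level m A1 A2 k c.
Let rho := Num.sqrt (F 1).
Let kap := kappa R m k.
Let w := gmean A1 A2.
Let eta := mean_support b2 u v.

Lemma cos2_bounds (p q : R) : p ^+ 2 + q ^+ 2 = 1 -> -1 <= p ^+ 2 - q ^+ 2 <= 1.
Proof. by have := sqr_ge0 p; have := sqr_ge0 q => ? ? ?; apply/andP; split; lra. Qed.

(** The support is attained by a point of the range, which obeys the outer bound; theta and - theta
    share the same c, so averaging preserves the inequality. *)
Lemma mean_support_le (c : R) : -1 <= c <= 1 -> eta c <= F c.
Proof.
move=> /andP[c0 c1].
have sup p q : p ^+ 2 + q ^+ 2 = 1 -> sq_support b2 u v p q <= F (p ^+ 2 - q ^+ 2).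
  move=> pq1; have [x [y [<- xyr]]] := sq_support_attained u v b2_gt0 pq1.
  have /range_support := xyr; move=> /(rank_num_range_le A_data A1_ge1 A2_ge1 km pq1).
  by rewrite addrK.
pose p := Num.sqrt ((1 + c) / 2); pose q := Num.sqrt ((1 - c) / 2).
have p2 : p ^+ 2 = (1 + c) / 2 by rewrite sqr_sqrtr //; lra.
have q2 : q ^+ 2 = (1 - c) / 2 by rewrite sqr_sqrtr //; lra.
have pq1 : p ^+ 2 + q ^+ 2 = 1 by rewrite p2 q2; field.
have cE : c = p ^+ 2 - q ^+ 2 by rewrite p2 q2; field.
rewrite cE /eta mean_supportE //.
have := sup p q pq1; have := sup p (- q); rewrite sqrrN => /(_ pq1); lra.
Qed.

(** Shrinking a point by 1 - t turns the weak bound into the strict one of [rank_num_range_near];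
    for small [t] the point stays near the vertex and a supposed violation of the conclusion
    persists. *)
Lemma near_vertex_sq_support : exists2 e : R, 0 < e & forall x y : R,
  `|x - rho| < e -> `|y| < e -> x * y != 0 ->
  (forall p q, p ^+ 2 + q ^+ 2 = 1 -> (p * x - q * y) ^+ 2 <= F (p ^+ 2 - q ^+ 2)) ->
  forall p q, p ^+ 2 + q ^+ 2 = 1 -> (p * x - q * y) ^+ 2 <= sq_support b2 u v p q.
Proof.
have [e e0 He] := rank_num_range_near A_data A1_ge1 A2_ge1 A12 km.
exists e => // x y xe ye xy0 below p q pq1.
set V := _ ^+ 2; set H := sq_support _ _ _ _ _.
rewrite leNgt; apply/negP => HV.
have H0 : 0 < H by rewrite ltr_pwDl // sqr_ge0.
have V0 : 0 < V by exact: lt_trans HV.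
have x1 : 0 < `|x| + 1 by rewrite ltr_wpDl.
have [||| t [t0 t1 t2' t3']] := @pos_lower_bound3 R (1 / 2)
    ((e - `|x - rho|) / (2 * (`|x| + 1))) ((V - H) / (4 * V)).
- by lra.
- by rewrite divr_gt0 ?subr_gt0 // mulr_gt0.
- by rewrite divr_gt0 ?subr_gt0 // mulr_gt0.
have t2 : t * (2 * (`|x| + 1)) <= e - `|x - rho| by rewrite -ler_pdivlMr ?mulr_gt0 //.
have t3 : t * (4 * V) <= V - H.
  by rewrite -ler_pdivlMr; [exact: t3' | apply: mulr_gt0].
have s1 : 0 < 1 - t < 1 by apply/andP; split; lra.
have Hs : rank_num_range k A ((((1 - t) * x) +i* ((1 - t) * y))%C + a).
  apply: He.
  - have -> : (1 - t) * x - rho = (x - rho) - t * x by ring.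
    rewrite (le_lt_trans (ler_normB _ _)) // normrM (gtr0_norm t0).
    have := normr_ge0 x; nra.
  - rewrite normrM (le_lt_trans _ ye) // ler_piMl // ger0_norm; lra.
  - have -> : (1 - t) * x * ((1 - t) * y) = (1 - t) ^+ 2 * (x * y) by ring.
    by rewrite mulf_neq0 // expf_neq0 // gt_eqF; case/andP: s1.
  move=> p' q' pq1'.
  have -> : p' * ((1 - t) * x) - q' * ((1 - t) * y) = (1 - t) * (p' * x - q' * y) by ring.
  have /andP[c1 _] := cos2_bounds pq1'.
  have Fgt := sq_level_gt0 A1_ge1 A2_ge1 A12 km c1.
  have := below p' q' pq1'; rewrite -/(F _) in Fgt *.
  have s2 : (1 - t) ^+ 2 < 1 by rewrite exprn_ilt1 //; case/andP: s1 => ? ? //; exact: ltW.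
  rewrite exprMn => Wf; apply: le_lt_trans (_ : (1 - t) ^+ 2 * F (p' ^+ 2 - q' ^+ 2) < _).
    by rewrite ler_wpM2l ?sqr_ge0.
  by rewrite gtr_pMl.
have /range_support/(_ p q pq1) := Hs.
have -> : p * ((1 - t) * x) - q * ((1 - t) * y) = (1 - t) * (p * x - q * y) by ring.
rewrite exprMn -/V -/H => Hle.
nra.
Qed.

(* The point of the ellipse h^2 = al p^2 + be q^2 with outer normal (p0, q0), and its conjugate. *)
Lemma contact_point (e al be p0 q0 : R) :
  (forall x y : R,
  `|x - rho| < e -> `|y| < e -> x * y != 0 ->
  (forall p q, p ^+ 2 + q ^+ 2 = 1 -> (p * x - q * y) ^+ 2 <= F (p ^+ 2 - q ^+ 2)) ->
  forall p q, p ^+ 2 + q ^+ 2 = 1 -> (p * x - q * y) ^+ 2 <= sq_support b2 u v p q) ->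
  0 < al -> 0 < be -> 0 < p0 -> 0 < q0 -> p0 ^+ 2 + q0 ^+ 2 = 1 ->
  let h := Num.sqrt (al * p0 ^+ 2 + be * q0 ^+ 2) in
  `|al * p0 / h - rho| < e -> `|be * q0 / h| < e ->
  (forall p q, p ^+ 2 + q ^+ 2 = 1 ->
     (p * (al * p0 / h) - q * (be * q0 / h)) ^+ 2 <= F (p ^+ 2 - q ^+ 2)) ->
  al * p0 ^+ 2 + be * q0 ^+ 2 <= eta (p0 ^+ 2 - q0 ^+ 2).
Proof.
move=> He al0 be0 p00 q00 pq1 h xe ye below.
have hh0 : 0 < al * p0 ^+ 2 + be * q0 ^+ 2 by rewrite addr_gt0 // mulr_gt0 // exprn_gt0.
have h0 : 0 < h by rewrite sqrtr_gt0.
have h2 : h ^+ 2 = al * p0 ^+ 2 + be * q0 ^+ 2 by rewrite sqr_sqrtr // ltW.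
have hn : h != 0 by rewrite gt_eqF.
set x := al * p0 / h in xe below *; set y := be * q0 / h in ye below *.
have xy0 : x * y != 0.
  by rewrite /x /y !mulf_neq0 ?invr_eq0 ?gt_eqF.
have hE : p0 * x + q0 * y = h.
  rewrite /x /y; apply: (mulIf hn); rewrite -[RHS]expr2 h2; by field.
rewrite /eta mean_supportE //.
have S1 := He x y xe ye xy0 below p0 (- q0).
rewrite sqrrN in S1; have {}S1 := S1 pq1.
rewrite mulNr opprK hE h2 in S1.
have S2 := He x (- y) xe; rewrite normrN mulrN oppr_eq0 in S2.
have {}S2 := S2 ye xy0.
have below' p q : p ^+ 2 + q ^+ 2 = 1 -> (p * x - q * - y) ^+ 2 <= F (p ^+ 2 - q ^+ 2).
  move=> pq; have := below p (- q); rewrite sqrrN => /(_ pq).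
  by rewrite mulrN mulNr.
have {}S2 := S2 below' p0 q0 pq1.
rewrite mulrN opprK hE h2 in S2.
lra.
Qed.

(** Cauchy-Schwarz for the form with weights [al], [be]: the contact point lies in its ellipse. *)
Lemma ellipse_normal_le (al be p0 q0 p q : R)
    (h := Num.sqrt (al * p0 ^+ 2 + be * q0 ^+ 2)) :
  0 < al -> 0 < be -> 0 < p0 ->
  (p * (al * p0 / h) - q * (be * q0 / h)) ^+ 2 <= al * p ^+ 2 + be * q ^+ 2.
Proof.
move=> al0 be0 p00.
have hh0 : 0 < al * p0 ^+ 2 + be * q0 ^+ 2.
  by rewrite ltr_pwDl ?mulr_gt0 ?exprn_gt0 // mulr_ge0 ?sqr_ge0 // ltW.
have h2 : h ^+ 2 = al * p0 ^+ 2 + be * q0 ^+ 2 by rewrite sqr_sqrtr // ltW.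
have hn : h != 0 by rewrite gt_eqF // sqrtr_gt0.
have -> : p * (al * p0 / h) - q * (be * q0 / h) = (al * p * p0 - be * q * q0) / h by field.
rewrite expr_div_n ler_pdivrMr ?exprn_gt0 ?sqrtr_gt0 // h2 -subr_ge0.
have -> : (al * p ^+ 2 + be * q ^+ 2) * (al * p0 ^+ 2 + be * q0 ^+ 2)
   - (al * p * p0 - be * q * q0) ^+ 2 = al * be * (p * q0 + q * p0) ^+ 2 by ring.
by rewrite mulr_ge0 ?sqr_ge0 // mulr_ge0 // ltW.
Qed.

End EllipseContradiction.

Section EllipseImpossible.
Variables (R : realType) (m : nat).
Local Notation C := R[i].
Local Notation n := m.*2.+1.
Variables (A : 'M[C]_n) (a : C) (A1 A2 : R).
Hypothesis A_data : recip_data A a A1 A2.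
Hypothesis A1_ge1 : 1 <= A1.
Hypothesis A2_ge1 : 1 <= A2.
Hypothesis A12 : A1 != A2.
Variable k : nat.
Hypothesis km : (0 < k <= m)%N.
Variables b2 u v : R.
Hypothesis b2_gt0 : 0 < b2.
Hypothesis range_support : forall x y, rank_num_range k A ((x +i* y)%C + a) <->
  forall p q, p ^+ 2 + q ^+ 2 = 1 -> (p * x - q * y) ^+ 2 <= sq_support b2 u v p q.

Let F (c : R) := sq_level m A1 A2 k c.
Let rho := Num.sqrt (F 1).
Let kap := kappa R m k.
Let w := gmean A1 A2.
Let eta := mean_support b2 u v.
Let S := (A1 + A2) / 2.

Let FE c : F c = S + c + kap * w c. Proof. by []. Qed.

Let F1_gt0 : 0 < F 1.
Proof. by apply: sq_level_gt0 => //; lra. Qed.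

Let rho2 : rho ^+ 2 = F 1.
Proof. by rewrite sqr_sqrtr // ltW. Qed.

Let rho_gt0 : 0 < rho.
Proof. by rewrite sqrtr_gt0. Qed.

(** F is strictly convex, so its tangent line at c0 near 1 stays below F and is the squared support
    function of an ellipse. Its contact point lies near the vertex, whence F(c0) <= eta(c0). Two
    such values of c0 contradict eta <= F at their midpoint, since eta is affine. *)
Lemma kappa_neg_impossible : kap < 0 -> False.
Proof.
have A1g := A1_ge1; have A2g := A2_ge1.
move=> kneg; have /andP[kN1 _] : -1 < kap < 1 := kappa_bounds R km.
have S1 : 1 < S by move: A12; rewrite /S neq_lt => /orP[] ?; lra.
have [e e0 He] := near_vertex_sq_support A_data A1_ge1 A2_ge1 A12 km b2_gt0 range_support.
pose c0 (s : R) : R := 1 - 2 * s ^+ 2.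
pose p0 (s : R) : R := Num.sqrt (1 - s ^+ 2).
(* [al] and [be] are the values at c = 1 and c = -1 of the tangent line to F at [c0 s]. *)
pose al (s : R) : R := S + 1 + kap * polar A1 A2 1 (c0 s) / w (c0 s).
pose be (s : R) : R := S - 1 + kap * polar A1 A2 (-1) (c0 s) / w (c0 s).
pose h (s : R) : R := Num.sqrt (al s * p0 s ^+ 2 + be s * s ^+ 2).
pose X (s : R) : R := al s * p0 s / h s.
pose Y (s : R) : R := be s * s / h s.
have c00 : c0 0 = 1 by rewrite /c0; ring.
have p00 : p0 0 = 1 by rewrite /p0 expr0n subr0 sqrtr1.
have w1 : 0 < w 1 by apply: gmean_gt0 => //; lra.
have al0 : al 0 = rho ^+ 2.
  have p11 : polar A1 A2 1 1 = w 1 ^+ 2.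
    by rewrite gmean_sqr //; [rewrite /polar; field | lra].
  by rewrite rho2 FE /al c00 p11; field; rewrite gt_eqF.
have h0 : h 0 = rho.
  by rewrite /h p00 al0 expr1n mulr1 expr0n mulr0 addr0 sqrtr_sqr gtr0_norm.
have X0 : X 0 = rho by rewrite /X p00 al0 h0; field; rewrite gt_eqF.
have Y0 : Y 0 = 0 by rewrite /Y mulr0 mul0r.
have alc : al s @[s --> 0^'+] --> al 0.
  rewrite /al /w /gmean /polar /c0; cvg_arith.
  by have := c00; rewrite /c0 => ->; rewrite gt_eqF.
have bec : be s @[s --> 0^'+] --> be 0.
  rewrite /be /w /gmean /polar /c0; cvg_arith.
  by have := c00; rewrite /c0 => ->; rewrite gt_eqF.
have hc : h s @[s --> 0^'+] --> h 0 by rewrite /h /p0; cvg_arith.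
have hn0 : h 0 != 0 by rewrite h0 gt_eqF.
have Xc : X s @[s --> 0^'+] --> X 0 by rewrite /X /p0; cvg_arith.
have Yc : Y s @[s --> 0^'+] --> Y 0 by rewrite /Y; cvg_arith.
have HN : \forall s \near 0^'+, [/\ 0 < s, s < 1, 0 < al s, `|X s - rho| < e & `|Y s| < e].
  near=> s; split.
  - by near: s; exact: nbhs_right_gt.
  - by near: s; apply: nbhs_right_lt.
  - by near: s; apply: (cvgr_gt _ alc); rewrite al0 exprn_gt0.
  - rewrite distrC; near: s; move: Xc; rewrite X0 => /cvgrPdist_lt; exact.
  - rewrite -normrN -sub0r; near: s; move: Yc; rewrite Y0 => /cvgrPdist_lt; exact.
have contact s : [/\ 0 < s, s < 1, 0 < al s, `|X s - rho| < e & `|Y s| < e] ->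
    F (c0 s) <= eta (c0 s).
  move=> [s0 s1 als Xe Ye].
  have ss1 : s ^+ 2 < 1 by rewrite exprn_ilt1 // ltW.
  have ss0 : 0 < s ^+ 2 by rewrite exprn_gt0.
  have p2 : p0 s ^+ 2 = 1 - s ^+ 2 by rewrite sqr_sqrtr // subr_ge0 ltW.
  have p0s : 0 < p0 s by rewrite sqrtr_gt0 subr_gt0.
  have c0E : p0 s ^+ 2 - s ^+ 2 = c0 s by rewrite p2 /c0; ring.
  have pq1 : p0 s ^+ 2 + s ^+ 2 = 1 by rewrite p2; ring.
  have c1 : -1 < c0 s by rewrite /c0; lra.
  have w0 : 0 < w (c0 s) by exact: gmean_gt0.
  have wn : w (c0 s) != 0 by rewrite gt_eqF.
  have w2 : w (c0 s) ^+ 2 = (A1 + c0 s) * (A2 + c0 s) by rewrite gmean_sqr // ltW.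
  have bes : 0 < be s.
    (* The tangent line of the geometric mean takes at -1 a value of at most S - 1, so [be] exceeds
       (S - 1) (1 + kap) - (S - 1) kap z-type losses only up to the positive amount (1 + kap) (S -
       1). *)
    have pw : polar A1 A2 (-1) (c0 s) <= (S - 1) * w (c0 s).
      have Sw : 0 <= (S - 1) * w (c0 s).
        by apply: mulr_ge0; [rewrite subr_ge0 ltW | exact: ltW].
      have pg : 0 <= polar A1 A2 (-1) (c0 s) by apply: polar_ge0 => //; exact: ltW.
      rewrite -(@ler_pXn2r _ 2) // [((S - 1) * _) ^+ 2]exprMn w2 -subr_ge0.
      have -> : (S - 1) ^+ 2 * ((A1 + c0 s) * (A2 + c0 s)) - polar A1 A2 (-1) (c0 s) ^+ 2 =
        (A1 - A2) ^+ 2 / 4 * ((A1 - 1) * (A2 - 1) + (1 + c0 s) * (A1 - 1 + (A2 - 1))).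
        by rewrite /S /polar; field.
      apply: mulr_ge0; first by rewrite divr_ge0 ?sqr_ge0.
      by apply: addr_ge0; apply: mulr_ge0; lra.
    have : polar A1 A2 (-1) (c0 s) / w (c0 s) <= S - 1 by rewrite ler_pdivrMr.
    rewrite /be -mulrA; move: (_ / w (c0 s)) => z zS.
    have kz : kap * (S - 1) <= kap * z by rewrite ler_wnM2l // ltW.
    have : 0 < (1 + kap) * (S - 1) by apply: mulr_gt0; [lra | rewrite subr_gt0].
    lra.
  have tauE p q : p ^+ 2 + q ^+ 2 = 1 -> al s * p ^+ 2 + be s * q ^+ 2 =
      S + (p ^+ 2 - q ^+ 2) + kap * (polar A1 A2 (p ^+ 2 - q ^+ 2) (c0 s) / w (c0 s)).
    move=> pq; have q2 : q ^+ 2 = 1 - p ^+ 2 by rewrite -pq; ring.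
    by rewrite q2 /al /be /polar; field.
  have tau0 : al s * p0 s ^+ 2 + be s * s ^+ 2 = F (c0 s).
    rewrite tauE // c0E FE; congr (_ + _ * _).
    have -> : polar A1 A2 (c0 s) (c0 s) = w (c0 s) ^+ 2 by rewrite w2 /polar; field.
    by field.
  rewrite -tau0 -c0E; apply: (contact_point He) => // p q pq.
  apply: le_trans (ellipse_normal_le _ _ _ als bes p0s) _.
  rewrite tauE // -/(F (p ^+ 2 - q ^+ 2)) FE lerD2l ler_wnM2l ?(ltW kneg) // ler_pdivlMr //.
  by apply: gmean_polar_le => //; [case/andP: (cos2_bounds pq) | exact: ltW].
move: HN => /nbhs_ballP[d /= d0 Hd].
have Hd' s : 0 < s -> s < d -> s < 1 /\ F (c0 s) <= eta (c0 s).
  move=> s0 sd; have Hs : ball 0 d s by rewrite /ball /= sub0r normrN gtr0_norm.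
  have [? s1 ? ? ?] := Hd s Hs s0; split=> //.
  exact: contact (Hd s Hs s0).
have [lt1 G1] := Hd' (d / 2) ltac:(lra) ltac:(lra).
have [lt2 G2] := Hd' (d / 3) ltac:(lra) ltac:(lra).
have cb s : 0 < s -> s < 1 -> -1 <= c0 s <= 1.
  move=> s0 s1; have ss1 : s ^+ 2 < 1 by rewrite exprn_ilt1 // ltW.
  have ss0 : 0 < s ^+ 2 by rewrite exprn_gt0.
  by rewrite /c0; apply/andP; split; lra.
have /andP[b1 b1'] := cb (d / 2) ltac:(lra) lt1.
have /andP[b3 b3'] := cb (d / 3) ltac:(lra) lt2.
have uu : c0 (d / 2) != c0 (d / 3).
  have d2 : 0 < d ^+ 2 by rewrite exprn_gt0.
  by rewrite /c0 lt_eqF //; lra.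
move: (c0 _) (c0 (d / 3)) G1 G2 b1 b1' b3 b3' uu => c1 c2 G1 G2 b1 b1' b3 b3' uu.
have mid := gmean_midpoint A1_ge1 A2_ge1 A12 uu b1 b3.
have := mean_support_le A_data A1_ge1 A2_ge1 km b2_gt0 range_support.
move=> /(_ ((c1 + c2) / 2) ltac:(apply/andP; split; lra)).
rewrite -/(F _) -/eta !FE.
have -> : eta ((c1 + c2) / 2) = (eta c1 + eta c2) / 2 by rewrite /eta /mean_support; field.
rewrite !FE in G1 G2.
have := ltr_nM2l kneg (w ((c1 + c2) / 2)) ((w c1 + w c2) / 2); rewrite -/w in mid; rewrite mid.
by move=> ? ?; lra.
Unshelve. all: by end_near.
Qed.
(** F is strictly concave, so the secant through its points at 0 and 1 takes at -1 a value [be]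
    above F(-1). The ellipse with squared support F(1) p^2 + be q^2 violates the bound only for c <
    0, but its contact points near the vertex satisfy it there too. Hence eta exceeds the secant at
    some c < 1, against eta(1) <= F(1) and eta(-1) <= F(-1) < be. *)
Lemma kappa_pos_impossible : 0 < kap -> False.
Proof.
have A1g := A1_ge1; have A2g := A2_ge1.
move=> kpos.
have [e e0 He] := near_vertex_sq_support A_data A1_ge1 A2_ge1 A12 km b2_gt0 range_support.
have eta_le := mean_support_le A_data A1_ge1 A2_ge1 km b2_gt0 range_support.
pose be : R := 2 * F 0 - F 1.
have FN1 : 0 < F (-1) by apply: sq_level_gt0.
have beF : F (-1) < be.
  have := @gmean_midpoint R A1 A2 A1_ge1 A2_ge1 (-1) 1 A12.
  have -> : (-1 + 1) / 2 = 0 :> R by ring.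
  have hn : -1 != 1 :> R by rewrite lt_eqF //; lra.
  move=> /(_ hn (lexx _) ltac:(lra)) => mid; rewrite /be !FE -/w in mid *.
  have := ltr_pM2l kpos ((w (-1) + w 1) / 2) (w 0); rewrite mid => kmid.
  lra.
have be0 : 0 < be by exact: lt_trans FN1 beF.
pose p0 (s : R) : R := Num.sqrt (1 - s ^+ 2).
pose h (s : R) : R := Num.sqrt (F 1 * p0 s ^+ 2 + be * s ^+ 2).
pose X (s : R) : R := F 1 * p0 s / h s.
pose Y (s : R) : R := be * s / h s.
have p00 : p0 0 = 1 by rewrite /p0 expr0n subr0 sqrtr1.
have h0 : h 0 = rho by rewrite /h p00 expr1n mulr1 expr0n mulr0 addr0.
have X0 : X 0 = rho by rewrite /X p00 -rho2 h0; field; rewrite gt_eqF.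
have Y0 : Y 0 = 0 by rewrite /Y mulr0 mul0r.
have hc : h s @[s --> 0^'+] --> h 0 by rewrite /h /p0; cvg_arith.
have hn0 : h 0 != 0 by rewrite h0 gt_eqF.
have Xc : X s @[s --> 0^'+] --> X 0 by rewrite /X /p0; cvg_arith.
have Yc : Y s @[s --> 0^'+] --> Y 0 by rewrite /Y; cvg_arith.
(* For c < 0 concavity leaves a slack F(-1) / 2 between F(1) p^2 and F(c); the last bound keeps the
   error 4 e' (rho + 1) within it. *)
have [||| e' [e'0 e'e e'1 e'F]] := @pos_lower_bound3 R e 1 (F (-1) / (8 * (rho + 1))) => //.
  by apply: divr_gt0 => //; apply: mulr_gt0 => //; apply: addr_gt0.
have [s [s0 s1 Xe Ye]] : exists s, [/\ 0 < s, s < 1, `|X s - rho| < e' & `|Y s| < e'].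
  have HN : \forall s \near 0^'+, [/\ 0 < s, s < 1, `|X s - rho| < e' & `|Y s| < e'].
    near=> s; split.
    - by near: s; exact: nbhs_right_gt.
    - by near: s; apply: nbhs_right_lt.
    - rewrite distrC; near: s; move: Xc; rewrite X0 => /cvgrPdist_lt; exact.
    - rewrite -normrN -sub0r; near: s; move: Yc; rewrite Y0 => /cvgrPdist_lt; exact.
  by have [s Hs] := filter_ex HN; exists s.
have ss1 : s ^+ 2 < 1 by rewrite exprn_ilt1 // ltW.
have ss0 : 0 < s ^+ 2 by rewrite exprn_gt0.
have p2 : p0 s ^+ 2 = 1 - s ^+ 2 by rewrite sqr_sqrtr // subr_ge0 ltW.
have p0s : 0 < p0 s by rewrite sqrtr_gt0 subr_gt0.
have pq1 : p0 s ^+ 2 + s ^+ 2 = 1 by rewrite p2; ring.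
have : F 1 * p0 s ^+ 2 + be * s ^+ 2 <= eta (p0 s ^+ 2 - s ^+ 2).
  apply: (contact_point He) => //; rewrite ?(lt_le_trans _ e'e) //.
  move=> p q pq; set c := p ^+ 2 - q ^+ 2; have /andP[cN1 c1] := cos2_bounds pq.
  rewrite -/c in cN1 c1.
  have [c0|c0] := leP 0 c.
    apply: le_trans (ellipse_normal_le _ _ _ F1_gt0 be0 p0s) _.
    have -> : F 1 * p ^+ 2 + be * q ^+ 2 = (1 - c) * F 0 + c * F 1.
      have q2 : q ^+ 2 = 1 - p ^+ 2 by rewrite -pq; ring.
      by rewrite /be /c q2; ring.
    have := @gmean_concave R A1 A2 A1_ge1 A2_ge1 0 1 c.
    rewrite mulr0 add0r mulr1 c0 c1 => /(_ ltac:(lra) ltac:(lra) isT ltac:(lra)).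
    rewrite -/w -(ler_pM2l kpos) -/(F c) !FE => H; lra.
  have p2c : p ^+ 2 = (1 + c) / 2 by rewrite /c; lra.
  have Fc : F 1 * p ^+ 2 + F (-1) / 2 <= F c.
    have Fc' : F 1 * ((1 + c) / 2) + F (-1) * (1 - (1 + c) / 2) <= F c.
      have [cE|cN] := eqVneq c (-1); first by rewrite cE; lra.
      have cN1' : -1 < c by rewrite lt_neqAle eq_sym cN.
      have := @gmean_concave R A1 A2 A1_ge1 A2_ge1 (-1) 1 ((1 + c) / 2).
      have -> : (1 - (1 + c) / 2) * -1 + (1 + c) / 2 * 1 = c by field.
      move=> /(_ (lexx _) ltac:(lra) ltac:(apply/andP; split; lra) cN1').
      rewrite -/w -(ler_pM2l kpos) !FE => H; lra.
    rewrite p2c; nra.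
  have q1 : `|q| <= 1.
    by rewrite -(@ler_pXn2r _ 2) ?nnegrE // real_normK ?num_real // expr1n -pq lerDr sqr_ge0.
  have p1 : `|p| <= 1.
    by rewrite -(@ler_pXn2r _ 2) ?nnegrE // real_normK ?num_real // expr1n -pq lerDl sqr_ge0.
  have up : `|p * X s - q * Y s| <= rho * `|p| + 2 * e'.
    have -> : p * X s - q * Y s = p * rho + (p * (X s - rho) - q * Y s) by ring.
    apply: le_trans (ler_normD _ _) _; rewrite normrM (gtr0_norm rho_gt0) mulrC lerD2l.
    apply: le_trans (ler_normB _ _) _; rewrite (normrM p) (normrM q) mulr_natl mulr2n.
    by apply: lerD; rewrite -[leRHS]mul1r; apply: ler_pM => //;
      [exact: (ltW Xe) | exact: (ltW Ye)].
  rewrite -/(X s) -/(Y s) -/c -/(F c) -[_ ^+ 2]real_normK ?num_real //.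
  apply: (@le_trans _ _ ((rho * `|p| + 2 * e') ^+ 2)).
    by rewrite ler_pXn2r ?nnegrE // (le_trans _ up).
  have e'F' : e' * (8 * (rho + 1)) <= F (-1).
    by rewrite -ler_pdivlMr // mulr_gt0 // addr_gt0.
  have -> : (rho * `|p| + 2 * e') ^+ 2 = rho ^+ 2 * `|p| ^+ 2 + 4 * e' * (rho * `|p|) + 4 * e' * e' by ring.
  rewrite real_normK ?num_real // rho2.
  have : e' * (rho * `|p|) <= e' * rho by rewrite ler_wpM2l ?(ltW e'0) // ler_piMr // ltW.
  have : e' * e' <= e' * 1 by rewrite ler_wpM2l // ltW.
  lra.
have := eta_le 1 ltac:(apply/andP; split; lra).
have := eta_le (-1) ltac:(apply/andP; split; lra).
rewrite -/(F 1) -/(F (-1)) /eta /mean_support p2 => HN1 H1 H.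
have : (1 - s ^+ 2) * (b2 + u ^+ 2) <= (1 - s ^+ 2) * F 1.
  by rewrite ler_wpM2l ?subr_ge0 ?(ltW ss1) //; lra.
have : s ^+ 2 * (b2 + v ^+ 2) < s ^+ 2 * be.
  by rewrite ltr_pM2l //; lra.
lra.
Unshelve. all: by end_near.
Qed.

End EllipseImpossible.

(** * The theorem *)

Section LargeRank.
Variables (R : realType) (m : nat).
Local Notation C := R[i].
Local Notation n := m.*2.+1.
Variables (A : 'M[C]_n) (a : C) (A1 A2 : R).
Hypothesis A_data : recip_data A a A1 A2.

(* Vectors supported on the positions 0, 2, .., m.*2 form an isotropic space of dimension m.+1. *)
Lemma rank_num_range_large k z : (m < k)%N -> rank_num_range k A z -> z = a.
Proof.
have [A_tridiag A_diag _ _] := A_data.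
move=> mk /rank_num_rangeP[U Uu UA].
have odd_lt (j : 'I_m) : (j.*2.+1 < n)%N by have := ltn_ord j; clear; lia.
pose N := colsub (fun j : 'I_m => Ordinal (odd_lt j)) U.
have : kermx N != 0.
  rewrite kermx_eq0 /row_free; apply: contraTneq mk => <-.
  by rewrite -leqNgt rank_leq_col.
move=> /rowV0Pn[al /sub_kermxP aN al0].
pose v := al *m U.
have v0 (i : 'I_n) : odd i -> v 0 i = 0.
  move=> io; have ih : (i./2 < m)%N by have := ltn_ord i; have := odd_double_half i; rewrite io; clear; lia.
  have E : (al *m N) 0 (Ordinal ih) = 0 by rewrite aN mxE.
  rewrite mxE in E; rewrite /v mxE -[RHS]E; apply: eq_bigr => j _.
  rewrite [N _ _]mxE; congr (_ * U _ _); apply: val_inj => /=.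
  by rewrite -[LHS](odd_double_half i) io.
have vAv : v *m centered A a *m v^t* = 0.
  apply/matrixP => i j; rewrite (ord1 i) (ord1 j) [LHS]mxE [RHS]mxE big1 // => s _.
  rewrite mxE big_distrl /= big1 // => t _.
  rewrite [(v^t*) _ _]mxE [(v^T) _ _]mxE.
  have [so|se] := boolP (odd s); first by rewrite (v0 s so) conjC0 mulr0.
  have [to|te] := boolP (odd t); first by rewrite (v0 t to) !mul0r.
  rewrite !mxE; have [->|ts] := eqVneq t s; first by rewrite A_diag subrr mulr0 mul0r.
  rewrite A_tridiag ?mulr0n ?subr0 ?mulr0 ?mul0r //.
  by move: ts se te; rewrite -val_eqE /=; clear; lia.
have aa : al *m al^t* = v *m v^t*.
  by rewrite /v trmx_mul map_mxM mulmxA -(mulmxA al) (unitarymxP Uu) mulmx1.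
have : (z - a)%:M *m (al *m al^t*) = 0.
  rewrite mulmxA -scalar_mxC raddfB /= -UA mulmxBr mulmxBl !mulmxA.
  rewrite -vAv /centered mulmxBr mulmxBl; congr (_ - _).
    by rewrite /v trmx_mul map_mxM !mulmxA.
  by rewrite !mul_mx_scalar -!scalemxAl aa.
rewrite mul_scalar_mx => /eqP; rewrite scaler_eq0 subr_eq0 => /orP[/eqP//|/eqP aa0].
suff : al = 0 by move/eqP; rewrite (negbTE al0).
apply/rowP => i; rewrite [RHS]mxE; have /matrixP/(_ 0 0) := aa0; rewrite !mxE => /eqP.
rewrite psumr_eq0 => [/allP/(_ i (mem_index_enum i)) | j _]; rewrite !mxE -normCK ?exprn_ge0 //.
by rewrite /= expf_eq0 /= normr_eq0 => /eqP.
Qed.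

(** Both foci belong to the disk, so both equal a; but then a + d / 2 belongs to it as well. *)
Lemma large_rank_not_elliptical k : (m < k)%N -> ~ elliptical_disk (rank_num_range k A).
Proof.
move=> mk [f1 [f2 [d [fd EE]]]].
have Ea z : `|z - f1| + `|z - f2| <= d%:C%C -> z = a.
  by move=> H; apply: (rank_num_range_large mk); rewrite EE.
have f1a : f1 = a by apply: Ea; rewrite subrr normr0 add0r ltW.
have f2a : f2 = a by apply: Ea; rewrite subrr normr0 addr0 distrC ltW.
have d0 : 0 < d by move: fd; rewrite f1a f2a subrr normr0 ltcE /= => /andP[].
have : a + (d / 2)%:C%C = a.
  apply: Ea; rewrite f1a f2a (addrAC a) subrr add0r.
  have -> : `|(d / 2)%:C%C| = (d / 2)%:C%C :> C by rewrite ger0_norm // ler0c divr_ge0 // ltW.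
  by rewrite -rmorphD lecR -splitr.
move=> /eqP; rewrite -subr_eq0 addrAC subrr add0r fmorph_eq0 => /eqP; lra.
Qed.

End LargeRank.

Section Dichotomy.
Variables (R : realType) (m : nat).
Local Notation C := R[i].
Local Notation n := m.*2.+1.
Variables (A : 'M[C]_n) (a : C) (A1 A2 : R).
Hypothesis A_data : recip_data A a A1 A2.
Hypothesis A1_ge1 : 1 <= A1.
Hypothesis A2_ge1 : 1 <= A2.
Hypothesis A12 : A1 != A2.

Lemma elliptical_half_rank k : (0 < k)%N ->
  elliptical_disk (rank_num_range k A) -> k.*2 = m.+1.
Proof.
move=> k0 ell; have [km|mk] := leqP k m; last first.
  by have := large_rank_not_elliptical A_data mk ell.
have kkm : (0 < k <= m)%N by rewrite k0.
have [b2 [u [v [b20 sup]]]] := elliptical_support A_data ell.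
have [kpos|kneg|//] := ltngtP k.*2 m.+1.
  by have := kappa_pos_impossible A_data A1_ge1 A2_ge1 A12 kkm b20 sup (kappa_gt0 R kpos).
have := kappa_neg_impossible A_data A1_ge1 A2_ge1 A12 kkm b20 sup.
by move=> /(_ (kappa_lt0 R _ kneg)) []; lia.
Qed.

(** With kappa_k = 0 the bound is (S + 1) p^2 + (S - 1) q^2: semi-axes sqrt (S + 1) and sqrt (S -
    1), hence foci at distance sqrt 2 from a. *)
Lemma half_rank_elliptical k : k.*2 = m.+1 -> elliptical_disk (rank_num_range k A).
Proof.
have A1g := A1_ge1; have A2g := A2_ge1.
move=> km; set S := (A1 + A2) / 2.
have S1 : 1 < S by move: A12; rewrite /S neq_lt => /orP[] ?; lra.
have kkm : (0 < k <= m)%N by lia.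
pose r2 : R := Num.sqrt 2; pose r : R := Num.sqrt (S + 1).
have r22 : r2 ^+ 2 = 2 by rewrite sqr_sqrtr.
have rr : r ^+ 2 = S + 1 by rewrite sqr_sqrtr //; lra.
have r20 : 0 <= r2 by exact: sqrtr_ge0.
have r0 : 0 <= r by exact: sqrtr_ge0.
exists (a + (r2 +i* 0)%C), (a - (r2 +i* 0)%C), (2 * r); split.
  have -> : a + (r2 +i* 0)%C - (a - (r2 +i* 0)%C) = (2 * r2)%:C%C.
    by rewrite complexr0 rmorphM rmorph_nat /=; ring.
  rewrite ger0_norm ?ler0c ?mulr_ge0 // ltcR ltr_pM2l //.
  rewrite -(@ltr_pXn2r _ 2) ?nnegrE // r22 rr; lra.
apply/seteqP; split=> z; rewrite /mkset.
all: have zE : z = z - a + a by rewrite subrK.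
all: have -> : z - (a + (r2 +i* 0)%C) = z - a - (r2 +i* 0)%C by ring.
all: have -> : z - (a - (r2 +i* 0)%C) = z - a + (r2 +i* 0)%C by ring.
  move=> Hz; have := @rank_num_range_le _ _ _ _ _ _ A_data A1_ge1 A2_ge1 _ z _ _ kkm _ Hz.
  case: (z - a) => x y /= Hxy; apply/ellipse_supportP; first by rewrite mulr_ge0.
  move=> p q pq1; have := Hxy p q pq1; rewrite /sq_level kappa_eq0 // mul0r addr0.
  have -> : (2 * r) ^+ 2 / 4 = S + 1 by rewrite -rr; field.
  rewrite expr0n /= addr0 r22 mulr0 subr0 exprMn r22 -/S; lra.
move: zE; case: (z - a) => x y zE /ellipse_supportP-/(_ ltac:(by rewrite mulr_ge0)) Hxy.
rewrite zE; apply: (ellipse_sub_rank_num_range A_data) => //.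
rewrite -/S; set N := _ + _.
have N0 : 0 <= N by rewrite addr_ge0 // divr_ge0 ?sqr_ge0 //; lra.
(* The support inequality is tested in the normal direction (x / (S + 1), - y / (S - 1)), normalized
   by sqrt T, where it reads N^2 <= N. *)
pose T := (x / (S + 1)) ^+ 2 + (y / (S - 1)) ^+ 2.
have T0 : 0 <= T by rewrite addr_ge0 ?sqr_ge0.
have sp : S + 1 != 0 by rewrite gt_eqF //; lra.
have sm : S - 1 != 0 by rewrite gt_eqF //; lra.
have [T00|Tn] := eqVneq T 0.
  move/eqP: T00; rewrite paddr_eq0 ?sqr_ge0 // !expf_eq0 /= !mulf_eq0 !invr_eq0.
  rewrite (negbTE sp) (negbTE sm) !orbF => /andP[/eqP x0 /eqP y0].
  by rewrite /N x0 y0 expr0n /= !mul0r addr0.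
have Tpos : 0 < T by rewrite lt_neqAle eq_sym Tn.
pose t := Num.sqrt T; have t2 : t ^+ 2 = T by rewrite sqr_sqrtr.
have tn : t != 0 by rewrite gt_eqF // sqrtr_gt0.
have pq1 : (x / (S + 1) / t) ^+ 2 + (- (y / (S - 1) / t)) ^+ 2 = 1.
  by rewrite sqrrN !(expr_div_n _ t) -mulrDl t2 divff.
have := Hxy _ _ pq1.
have -> : x / (S + 1) / t * x - - (y / (S - 1) / t) * y = N / t.
  by rewrite /N; field; rewrite tn sp sm.
have -> : (2 * r) ^+ 2 / 4 - (r2 ^+ 2 + 0 ^+ 2) + (x / (S + 1) / t * r2 - - (y / (S - 1) / t) * 0) ^+ 2 = N / T.
  rewrite mulr0 subr0 [(_ * r2) ^+ 2]exprMn r22 expr0n /= addr0.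
  have -> : (2 * r) ^+ 2 / 4 = S + 1 by rewrite -rr; field.
  rewrite expr_div_n t2.
  transitivity (((S - 1) * T + 2 * (x / (S + 1)) ^+ 2) / T); first by field; rewrite ?sp ?Tn.
  by congr (_ / _); rewrite /T /N; field; rewrite sp sm.
rewrite expr_div_n t2 ler_pM2r ?invr_gt0 // => NN.
have [/eqP->|Nn] := boolP (N == 0); first by [].
by rewrite -(@ler_pM2l _ N) ?mulr1 -?expr2 // lt_neqAle eq_sym Nn.
Qed.

End Dichotomy.

Section PeriodicData.
Variables (R : realType) (m : nat).
Local Notation C := R[i].
Local Notation n := m.*2.+1.
Variable A : 'M[C]_n.
Hypothesis A_per : two_periodic A.
Hypothesis A_rec : reciprocal A.

Definition sq_pair (p : nat) : C := `|entry A p p.+1| ^+ 2 + `|entry A p.+1 p| ^+ 2.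

Lemma sq_pair_periodic p : (p.+3 < n)%N -> sq_pair p.+2 = sq_pair p.
Proof.
have [_ _ per] := A_per => p3.
have p2 : (p.+2 < n)%N by exact: ltnW.
have p1 : (p.+1 < n)%N by exact: ltnW.
have p0 : (p < n)%N by exact: ltnW.
rewrite /sq_pair (entry_ord _ p2 p3) (entry_ord _ p3 p2) (entry_ord _ p0 p1) (entry_ord _ p1 p0).
have := per (Ordinal p0) (Ordinal p1) (Ordinal p2) (Ordinal p3) erefl erefl erefl.
move=> H; have : \sum_(b <- [:: A (Ordinal p2) (Ordinal p3); A (Ordinal p3) (Ordinal p2)]) `|b| ^+ 2
    = \sum_(b <- [:: A (Ordinal p1) (Ordinal p0); A (Ordinal p0) (Ordinal p1)]) `|b| ^+ 2.
  exact: perm_big.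
by rewrite !big_cons !big_nil /= !addr0 => ->; rewrite addrC.
Qed.

(** Opposite entries have product 1, so the arithmetic-geometric inequality bounds the mean of their
    squared moduli below by 1. *)
Lemma sq_pair_ge p : (p.+1 < n)%N -> exists2 r : R, 1 <= r & sq_pair p = (2 * r)%:C%C.
Proof.
have [_ _ recip] := A_rec => p1; have p0 : (p < n)%N by exact: ltnW.
rewrite /sq_pair (entry_ord _ p0 p1) (entry_ord _ p1 p0).
have := recip (Ordinal p0) (Ordinal p1) erefl.
move: (A _ _) (A _ (Ordinal p0)) => [b b'] [c c'] /(congr1 (fun z : C => `|z| ^+ 2)).
rewrite normrM exprMn normr1 expr1n -!add_Re2_Im2 /= -rmorphM => /complexI E.
exists ((b ^+ 2 + b' ^+ 2 + (c ^+ 2 + c' ^+ 2)) / 2); last by rewrite -rmorphD; congr (_%:C%C); field.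
have := sqr_ge0 (b ^+ 2 + b' ^+ 2 - (c ^+ 2 + c' ^+ 2)).
have := sqr_ge0 b; have := sqr_ge0 b'; have := sqr_ge0 c; have := sqr_ge0 c'.
move: (b ^+ 2) (b' ^+ 2) (c ^+ 2) (c' ^+ 2) E => x1 x2 y1 y2 E ? ? ? ? ?; nra.
Qed.

Lemma periodic_recip_data : (0 < m)%N -> offdiag_mean A 1 <> offdiag_mean A 2 ->
  exists a A1 A2, [/\ recip_data A a A1 A2, 1 <= A1, 1 <= A2 & A1 != A2].
Proof.
move=> m0 hA; have [A_tridiag A_diag A_recip] := A_rec.
have n1 : (1 < n)%N by move: m0; clear; lia.
have n2 : (2 < n)%N by move: m0; clear; lia.
have [A1 A1_ge1 E1] := sq_pair_ge n1; have [A2 A2_ge1 E2] := sq_pair_ge n2.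
have meanE p : offdiag_mean A p.+1 = sq_pair p / 2.
  by rewrite /offdiag_mean /sq_pair addrC.
exists (A ord0 ord0), A1, A2; split => //.
- split=> // i j ji; rewrite -(entryE A i j) -(entryE A j i) ji -/(sq_pair i).
  have : (i.+1 < n)%N by rewrite -ji.
  elim/ltn_ind: {j ji} (i : nat) => -[|[|p]] IH pn //.
  rewrite sq_pair_periodic // IH /= ?negbK //.
  by apply: ltn_trans pn; rewrite ltnS ltnW.
- apply/eqP => A12; apply: hA; rewrite !meanE E1 E2 A12 //.
Qed.

End PeriodicData.

Theorem theorem5 (R : realType) (n : nat) (A : 'M[R[i]]_n)
    (hn : (3 <= n)%N) (hodd : odd n)
    (hper : two_periodic A) (hrec : reciprocal A)
    (hA : offdiag_mean A 1 <> offdiag_mean A 2) :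
  (n = 1 %[mod 4] ->
     forall k : nat, (1 <= k <= n)%N -> ~ elliptical_disk (rank_num_range k A))
  /\
  (n = 3 %[mod 4] ->
     elliptical_disk (rank_num_range (n.+1 %/ 4) A) /\
     forall k : nat, (1 <= k <= n)%N ->
       elliptical_disk (rank_num_range k A) -> k = (n.+1 %/ 4)%N).
Proof.
have [m nE] : exists m, n = m.*2.+1.
  by exists n./2; rewrite -[LHS]odd_double_half hodd.
subst n; have m0 : (0 < m)%N by move: hn; clear; lia.
have [a [A1 [A2 [A_data A1_ge1 A2_ge1 A12]]]] := periodic_recip_data hper hrec m0 hA.
have half k := @elliptical_half_rank R m A a A1 A2 A_data A1_ge1 A2_ge1 A12 k.
split=> nmod.
  move=> k /andP[k0 _] /(half k k0) km.
  by move: nmod km; clear; lia.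
split.
  apply: (half_rank_elliptical A_data A1_ge1 A2_ge1 A12).
  by move: nmod; clear; lia.
move=> k /andP[k0 _] /(half k k0) km.
by move: nmod km; clear; lia.
Qed.
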